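(* Every te-cone, that is, every simplicial cone generated by the rows of a totally equimodular matrix, admits a regular unimodular Hilbert triangulation.
   Context: A real matrix with $r$ rows and full row rank is equimodular if all its nonzero $r\times r$ minors have the same absolute value. A matrix is totally equimodular if every set of linearly independent rows forms an equimodular matrix. (In particular the nonzero entries of each row all have the same absolute value, so the cone generated by the rows is rational.) For a matrix with $n$ columns, the cone generated by its rows is the set of nonnegative real combinations of its rows in $\mathbb R^n$; it is simplicial if it is generated by linearly independent vectors. For a pointed rational cone $C\subseteq\mathbb R^n$, the Hilbert basis of $C$ is the unique minimal set of integer vectors in $C$ such that every element of $C\cap\mathbb Z^n$ is a nonnegative integer combination of them. A triangulation of $C$ is a finite collection of simplicial cones whose union is $C$, closed under taking faces, and such that the intersection of any two is a face of both. It is a Hilbert triangulation if each of its cones is generated by elements of the Hilbert basis of $C$. It is unimodular if each of its cones is generated by integer vectors forming a $\mathbb Z$-basis of the lattice of integer points in the linear span of that cone. It is regular if there is a continuous convex function on $C$, linear on each cone of the triangulation, whose maximal domains of linearity are exactly the maximal cones of the triangulation. *)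

(* Defs.v *)
From HB Require Import structures.
From mathcomp Require Import all_boot all_order all_algebra.
From mathcomp Require Import all_classical all_reals all_analysis.
Import Order.TTheory GRing.Theory Num.Theory.
Import numFieldNormedType.Exports.

Set Implicit Arguments.
Unset Strict Implicit.
Unset Printing Implicit Defensive.

Local Open Scope classical_set_scope.
Local Open Scope ring_scope.

(* The r x r minors of [M] are indexed by the increasing maps 'I_r -> 'I_n. *)
Definition equimodular (R : realType) (r n : nat) (M : 'M[R]_(r, n)) : Prop :=
  row_free M /\
  forall f g : 'I_r -> 'I_n,
    {homo f : i j / (i < j)%N} -> {homo g : i j / (i < j)%N} ->
    \det (colsub f M) != 0 -> \det (colsub g M) != 0 ->
    `|\det (colsub f M)| = `|\det (colsub g M)|.

Definition row_submx (R : realType) (m n : nat) (A : 'M[R]_(m, n))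
    (S : {set 'I_m}) : 'M[R]_(#|S|, n) :=
  rowsub (fun i : 'I_#|S| => enum_val i) A.

Definition totally_equimodular (R : realType) (m n : nat)
    (A : 'M[R]_(m, n)) : Prop :=
  forall S : {set 'I_m}, row_free (row_submx A S) ->
    equimodular (row_submx A S).

Definition row_cone (R : realType) (m n : nat) (A : 'M[R]_(m, n)) :
    set 'rV[R]_n :=
  [set x | exists2 c : 'rV[R]_m, (forall i, 0 <= c 0 i) & x = c *m A].

Definition simplicial (R : realType) (n : nat) (C : set 'rV[R]_n) : Prop :=
  exists (k : nat) (B : 'M[R]_(k, n)), row_free B /\ C = row_cone B.

Definition te_cone (R : realType) (n : nat) (C : set 'rV[R]_n) : Prop :=
  simplicial C /\
  exists (m : nat) (A : 'M[R]_(m, n)),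
    totally_equimodular A /\ C = row_cone A.

Definition integer_vector (R : realType) (n : nat) : set 'rV[R]_n :=
  [set x | forall j, x 0 j \is a Num.int].

Definition linear_span (R : realType) (n : nat) (K : set 'rV[R]_n) :
    set 'rV[R]_n :=
  [set x | exists (k : nat) (M : 'M[R]_(k, n)),
     (forall i, K (row i M)) /\ (x <= M)%MS].

Definition minimal_sets (T : Type) (P : set (set T)) : set (set T) :=
  [set D | P D /\ forall D', P D' -> D' `<=` D -> D' = D].

Definition maximal_sets (T : Type) (P : set (set T)) : set (set T) :=
  [set D | P D /\ forall D', P D' -> D `<=` D' -> D' = D].

Definition nat_combination (R : realType) (n : nat) (H : set 'rV[R]_n) :
    set 'rV[R]_n :=
  [set x | exists (k : nat) (h : 'I_k -> 'rV[R]_n) (c : 'I_k -> nat),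
     (forall i, H (h i)) /\ x = \sum_(i < k) h i *+ c i].

Definition integrally_generates (R : realType) (n : nat)
    (C H : set 'rV[R]_n) : Prop :=
  H `<=` C `&` @integer_vector R n /\
  C `&` @integer_vector R n `<=` nat_combination H.

(* [H] is the only minimal integral generating set of [C]. *)
Definition hilbert_basis (R : realType) (n : nat) (C H : set 'rV[R]_n) : Prop :=
  minimal_sets (integrally_generates C) = [set H].

(* Faces are cut out by supporting hyperplanes through the origin; [l = 0]
   makes [C] a face of itself. *)
Definition face_of (R : realType) (n : nat) (F C : set 'rV[R]_n) : Prop :=
  exists l : {scalar 'rV[R]_n},
    (forall x, C x -> 0 <= l x) /\ F = [set x | C x /\ l x = 0].

Definition triangulation (R : realType) (n : nat) (C : set 'rV[R]_n)
    (T : set (set 'rV[R]_n)) : Prop :=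
  [/\ finite_set T,
      forall K, T K -> simplicial K,
      \bigcup_(K in T) K = C,
      forall K F, T K -> face_of F K -> T F &
      forall K L, T K -> T L -> face_of (K `&` L) K /\ face_of (K `&` L) L].

Definition hilbert_triangulation (R : realType) (n : nat) (C : set 'rV[R]_n)
    (T : set (set 'rV[R]_n)) : Prop :=
  triangulation C T /\
  exists2 H : set 'rV[R]_n, hilbert_basis C H &
    forall K, T K -> exists (k : nat) (B : 'M[R]_(k, n)),
      (forall i, H (row i B)) /\ K = row_cone B.

Definition Z_basis (R : realType) (n k : nat) (L : set 'rV[R]_n)
    (B : 'M[R]_(k, n)) : Prop :=
  (forall i, L (row i B)) /\
  forall x, L x -> exists! z : 'rV[int]_k, x = map_mx intr z *m B.

Definition unimodular_triangulation (R : realType) (n : nat)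
    (C : set 'rV[R]_n) (T : set (set 'rV[R]_n)) : Prop :=
  triangulation C T /\
  forall K, T K -> exists (k : nat) (B : 'M[R]_(k, n)),
    K = row_cone B /\ Z_basis (linear_span K `&` @integer_vector R n) B.

Definition linear_on (R : realType) (n : nat) (D : set 'rV[R]_n)
    (f : 'rV[R]_n -> R) : Prop :=
  exists l : {scalar 'rV[R]_n}, forall x, D x -> f x = l x.

(* Domains of linearity are required to be convex: without this, a convex
   piecewise linear function can also have nonconvex maximal sets on which it
   agrees with a linear form. *)
Definition linearity_domain (R : realType) (n : nat) (C : set 'rV[R]_n)
    (f : 'rV[R]_n -> R) : set (set 'rV[R]_n) :=
  [set D | [/\ D `<=` C, @convex_set R 'rV[R]_n D & linear_on D f]].

Definition regular_triangulation (R : realType) (n : nat) (C : set 'rV[R]_n)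
    (T : set (set 'rV[R]_n)) : Prop :=
  triangulation C T /\
  exists f : 'rV[R]_n -> R,
    [/\ {within C, continuous f},
        @convex_function R 'rV[R]_n C f,
        forall K, T K -> linear_on K f &
        maximal_sets (linearity_domain C f) = maximal_sets T].

(* Main.v *)
(* After scaling, the cone is generated by independent rows with entries 0, 1, -1
   that are still totally equimodular.  By induction on the number of rows,
   contracting one row at a time, the coordinates of a lattice point with respect
   to the generators lie in (1/4)Z, and the rows with an odd quarter coordinate
   fall into even classes of rows with equal support, on which the differences of
   coordinates are half-integral.  Pair up the rows of each class and subdivide
   stellarly first at the midpoint of each pair, which makes all coordinates
   half-integral, and then at all irreducible lattice points of the cone.  If a
   cone of the result were not unimodular, a minimal set T of its generators with
   half their sum integral would make (sum T)/2 an irreducible point of that cone,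
   although every irreducible point lying in a cone of the result is one of its
   generators.  A stellar subdivision of a regular complex is regular, and all
   vertices used are irreducible, that is, belong to the Hilbert basis. *)
From HB Require Import structures.
Require Import Defs.
From mathcomp Require Import all_boot all_order all_algebra.
From mathcomp Require Import all_classical all_reals all_analysis.
From mathcomp Require Import fintype finset perm ring lra zify.
Import Order.TTheory GRing.Theory Num.Theory.
Import numFieldNormedType.Exports.
Set Implicit Arguments.
Unset Strict Implicit.
Unset Printing Implicit Defensive.
Local Open Scope ring_scope.

Section Integrality.
Variable R : archiRealFieldType.
Implicit Types x y : R.

Lemma half_notint : (2^-1 : R) \isn't a Num.int.
Proof.
apply/negP => /intrP[m hm].
have : (2 * m)%:~R = 1%:~R :> R by rewrite intrM -hm divff ?pnatr_eq0.
by move/intr_inj; lia.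
Qed.

Lemma int_halfP x : 2 * x \is a Num.int ->
  x \is a Num.int \/ x - 2^-1 \is a Num.int.
Proof.
move=> /intrP[m hm].
have -> : x = m%:~R / 2 by rewrite -hm mulrC mulKf ?pnatr_eq0.
have [k [->|->]] : exists k : int, m = 2 * k \/ m = 2 * k + 1.
  by exists (m %/ 2)%Z; lia.
- left; rewrite intrM mulrC mulKf ?pnatr_eq0 ?intr_int//.
- right; rewrite intrD intrM mulrDl (mulrC _ k%:~R) mulfK ?pnatr_eq0//.
  by rewrite mul1r addrK intr_int.
Qed.

Lemma odd_half_int (n : nat) : (n%:R / 2 : R) \is a Num.int -> ~~ odd n.
Proof.
move=> /intrP[m hm].
have : (n%:Z)%:~R = (2 * m)%:~R :> R.
  by rewrite intrM -hm mulrC divfK ?pnatr_eq0.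
by move/intr_inj; lia.
Qed.

Definition tern (x : R) := [|| x == 0, x == 1 | x == -1].

Lemma tern_int x : tern x -> x \is a Num.int.
Proof. by case/or3P => /eqP->; rewrite ?rpredN ?rpred0 ?rpred1. Qed.

Lemma tern_norm x : tern x = (`|x| == 0) || (`|x| == 1).
Proof.
rewrite /tern normr_eq0; case: (x == 0) => //=.
by rewrite eqr_norml ler01 andbT.
Qed.

Lemma tern_neq0 x : tern x -> x != 0 -> x = 1 \/ x = -1.
Proof. by case/or3P => /eqP->; rewrite ?eqxx//; [left|right]. Qed.

Lemma int_ge1 x : x \is a Num.int -> 0 < x -> 1 <= x.
Proof. by move=> /intrP[m ->]; rewrite ltr0z (ler_int _ 1); lia. Qed.

Lemma int_lt1 x : x \is a Num.int -> 0 <= x -> x < 1 -> x = 0.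
Proof.
move=> ia a0 a1; apply/eqP; rewrite eq_le a0 andbT leNgt; apply/negP => h.
by have := int_ge1 ia h; rewrite leNgt a1.
Qed.

Lemma half_lt1 x : 2 * x \is a Num.int -> 0 <= x -> x < 1 -> x = 0 \/ x = 2^-1.
Proof.
move=> ia a0 a1; have [h|h] := leP 1 (2 * x).
  right; have : 2 * x - 1 = 0 by apply: int_lt1; [rewrite rpredB ?rpred1|lra|lra].
  by lra.
by left; have := int_lt1 ia _ h; lra.
Qed.

End Integrality.

Section Tee.
Variable R : archiRealFieldType.

(* Total equimodularity through arbitrary index maps: a repeated index or
   dependent rows make the minor vanish, so no side condition is needed. *)
Definition tee (r n : nat) (A : 'M[R]_(r, n)) :=
  forall k (p : 'I_k -> 'I_r) (f g : 'I_k -> 'I_n),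
  \det (mxsub p f A) != 0 -> \det (mxsub p g A) != 0 ->
  `|\det (mxsub p f A)| = `|\det (mxsub p g A)|.

Definition tern_mx (r n : nat) (A : 'M[R]_(r, n)) := forall i j, tern (A i j).

Definition lat (r n : nat) (A : 'M[R]_(r, n)) (c : 'rV[R]_r) :=
  forall j, (c *m A) 0 j \is a Num.int.

Definition par (r n : nat) (A : 'M[R]_(r, n)) (i j : 'I_r) :=
  forall q, (A i q == 0) = (A j q == 0).

Lemma det_col_repl k (B B' : 'M[R]_k) (a : 'cV[R]_k) (c : 'I_k) :
  (forall i j, B' i j = if j == c then a i 0 else B i j) ->
  \det B' = (\adj B *m a) c 0.
Proof.
move=> hB; rewrite (expand_det_col _ c) mxE; apply: eq_bigr => i _.
rewrite hB eqxx mulrC; congr (_ * _); rewrite !mxE /cofactor; congr (_ * \det _).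
by apply/matrixP => x y; rewrite !mxE hB eq_sym (negbTE (neq_lift _ _)).
Qed.

Lemma det_row_repl k (B B' : 'M[R]_k) (a : 'rV[R]_k) (c : 'I_k) :
  (forall i j, B' i j = if i == c then a 0 j else B i j) ->
  \det B' = (a *m \adj B) 0 c.
Proof.
move=> hB; rewrite (expand_det_row _ c) mxE; apply: eq_bigr => i _.
rewrite hB eqxx; congr (_ * _); rewrite !mxE /cofactor; congr (_ * \det _).
by apply/matrixP => x y; rewrite !mxE hB eq_sym (negbTE (neq_lift _ _)).
Qed.

Lemma tee_coef r n (A : 'M[R]_(r, n)) k (p : 'I_k -> 'I_r) (g : 'I_k -> 'I_n)
    (j : 'I_n) : tee A -> mxsub p g A \in unitmx ->
  exists2 t : 'cV[R]_k, (forall c, tern (t c 0)) &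
    forall i, A (p i) j = \sum_c A (p i) (g c) * t c 0.
Proof.
move=> teA uB; set B := mxsub p g A in uB *.
pose a : 'cV[R]_k := \col_i A (p i) j.
exists (invmx B *m a) => [c|i]; last first.
  have : (B *m (invmx B *m a)) i 0 = a i 0 by rewrite mulKVmx.
  by rewrite [a i 0]mxE => <-; rewrite mxE; apply: eq_bigr => c _; rewrite !mxE.
have detB : \det B != 0 by rewrite unitmxE unitfE in uB.
pose g' x := if x == c then j else g x.
have e : \det (mxsub p g' A) = \det B * (invmx B *m a) c 0.
  rewrite /invmx uB -scalemxAl [in RHS]mxE mulrA divff// mul1r.
  apply: det_col_repl => x y; rewrite !mxE /g'.
  by case: ifP.
rewrite tern_norm normr_eq0; case: eqP => //= /eqP tn0.
have : \det (mxsub p g' A) != 0 by rewrite e mulf_neq0.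
move=> /(teA _ _ _ _) /(_ detB); rewrite e normrM -/B => h.
by apply/eqP/(mulfI (_ : `|\det B| != 0)); rewrite ?normr_eq0// mulr1.
Qed.

Lemma tee_lat r n (A : 'M[R]_(r, n)) (c : 'rV[R]_r) (g : 'I_r -> 'I_n) :
  tee A -> mxsub id g A \in unitmx ->
  (forall x, (c *m A) 0 (g x) \is a Num.int) -> lat A c.
Proof.
move=> teA uB hc j; have [t tt e] := tee_coef j teA uB.
have -> : (c *m A) 0 j = \sum_x (c *m A) 0 (g x) * t x 0.
  rewrite mxE (eq_bigr (fun i => \sum_x c 0 i * A i (g x) * t x 0)); last first.
    by move=> i _; rewrite e mulr_sumr; apply: eq_bigr => x _; rewrite mulrA.
  by rewrite exchange_big; apply: eq_bigr => x _; rewrite mxE mulr_suml.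
by apply: rpred_sum => x _; apply: rpredM; [exact: hc|exact: tern_int].
Qed.

Lemma tee_rowsub r n (A : 'M[R]_(r, n)) s (p : 'I_s -> 'I_r) :
  tee A -> tee (rowsub p A).
Proof.
move=> teA k q f g.
have e h : mxsub q h (rowsub p A) = mxsub (p \o q) h A.
  by apply/matrixP => i j; rewrite !mxE.
by rewrite !e; apply: teA.
Qed.

Lemma tee_scale r n (A : 'M[R]_(r, n)) (d : 'I_r -> R) :
  tee A -> tee (\matrix_(i, j) (d i * A i j)).
Proof.
move=> teA k p f g.
have e h : \det (mxsub p h (\matrix_(i, j) (d i * A i j))) =
    (\prod_i d (p i)) * \det (mxsub p h A).
  have -> : mxsub p h (\matrix_(i, j) (d i * A i j)) =
      diag_mx (\row_i d (p i)) *m mxsub p h A.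
    by apply/matrixP => i j; rewrite mul_diag_mx !mxE.
  rewrite det_mulmx det_diag; congr (_ * _).
  by apply: eq_bigr => i _; rewrite mxE.
rewrite !e !mulf_eq0 !negb_or => /andP[_ h1] /andP[_ h2].
by rewrite !normrM (teA _ _ _ _ h1 h2).
Qed.

Definition pivot r n (A : 'M[R]_(r.+1, n)) (t : 'I_r.+1) (p : 'I_n)
    : 'M[R]_(r, n) :=
  \matrix_(i, j) (A (lift t i) j - A (lift t i) p / A t p * A t j).

Lemma tee_pivot r n (A : 'M[R]_(r.+1, n)) t p :
  A t p != 0 -> tee A -> tee (pivot A t p).
Proof.
move=> ap0 teA k q f g.
pose q' (x : 'I_(1 + k)) := oapp (fun i => lift t (q i)) t (unlift ord0 x).
pose ext h (x : 'I_(1 + k)) : 'I_n := oapp h p (unlift ord0 x).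
have e h : A t p * \det (mxsub q h (pivot A t p)) = \det (mxsub q' (ext h) A).
  have -> : mxsub q' (ext h) A =
     block_mx 1%:M 0 (\col_i (A (lift t (q i)) p / A t p)) 1%:M *m
     block_mx (A t p)%:M (\row_j A t (h j)) 0 (mxsub q h (pivot A t p)).
    rewrite mulmx_block !mul1mx !mul0mx !addr0.
    apply/matrixP => i j; case: (split_ordP i) => i' ->; case: (split_ordP j) => j' ->.
    - rewrite block_mxEul !mxE /q' /ext !ord1.
      have -> : lshift k (0 : 'I_1) = ord0 by exact/val_inj.
      by rewrite unlift_none /= mulr1n.
    - rewrite block_mxEur !mxE /q' /ext !ord1.
      have -> : lshift k (0 : 'I_1) = ord0 by exact/val_inj.
      rewrite unlift_none.
      have -> : rshift 1 j' = lift ord0 j' by exact/val_inj.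
      by rewrite liftK.
    - rewrite block_mxEdl !mxE /q' /ext !ord1 big_ord1 !mxE eqxx mulr1n.
      have -> : lshift k (0 : 'I_1) = ord0 by exact/val_inj.
      rewrite unlift_none.
      have -> : rshift 1 i' = lift ord0 i' by exact/val_inj.
      by rewrite liftK /= divfK.
    - rewrite block_mxEdr !mxE /q' /ext big_ord1 !mxE.
      have -> : rshift 1 i' = lift ord0 i' by exact/val_inj.
      have -> : rshift 1 j' = lift ord0 j' by exact/val_inj.
      by rewrite !liftK /= addrCA subrr addr0.
  rewrite det_mulmx det_lblock det_ublock !det1 !mul1r.
  by rewrite det_scalar1.
move=> h1 h2; apply: (mulfI (_ : `|A t p| != 0)); first by rewrite normr_eq0.
by rewrite -!normrM !e; apply: teA; rewrite -e mulf_neq0.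
Qed.

End Tee.

(** * Supports of the rows *)

Section Rows.
Variable R : archiRealFieldType.

Lemma det2 (M : 'M[R]_2) : \det M = M 0 0 * M 1 1 - M 0 1 * M 1 0.
Proof.
rewrite (expand_det_row _ 0) !big_ord_recl big_ord0 addr0 /cofactor !det_mx11.
rewrite !mxE /= expr0 expr1 mul1r mulN1r mulrN.
have -> : lift 0 0 = 1 :> 'I_2 by exact/val_inj.
by have -> : lift 1 0 = 0 :> 'I_2 by exact/val_inj.
Qed.

Lemma par_refl r n (A : 'M[R]_(r, n)) i : par A i i. Proof. by []. Qed.
Lemma par_sym r n (A : 'M[R]_(r, n)) i j : par A i j -> par A j i.
Proof. by move=> h q; rewrite h. Qed.
Lemma par_trans r n (A : 'M[R]_(r, n)) i j k :
  par A i j -> par A j k -> par A i k.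
Proof. by move=> h h' q; rewrite h h'. Qed.

Lemma tee_minor2 r n (A : 'M[R]_(r, n)) i j (q1 q2 q3 q4 : 'I_n) : tee A ->
  let m x y := A i x * A j y - A i y * A j x in
  m q1 q2 != 0 -> m q3 q4 != 0 -> `|m q1 q2| = `|m q3 q4|.
Proof.
move=> teA m.
pose pr T (x y : T) (a : 'I_2) := if a == 0 then x else y.
have e x y : \det (mxsub (pr _ i j) (pr _ x y) A) = m x y.
  by rewrite det2 !mxE.
by rewrite -!e; apply: teA.
Qed.

Lemma par_or_coherent r n (A : 'M[R]_(r, n)) i j : tee A -> tern_mx A ->
  par A i j \/ exists2 s : R, s = 1 \/ s = -1 &
    forall q, A i q != 0 -> A j q != 0 -> A j q = s * A i q.
Proof.
move=> teA trA.
have [[q1 [i1 e1]]|no1] := pselect (exists q, A i q != 0 /\ A j q = A i q); last first.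
  right; exists (-1); first by right.
  move=> q iq jq; have : A j q != A i q by apply/eqP => e; apply: no1; exists q.
  by case: (tern_neq0 (trA i q) iq) => ->; case: (tern_neq0 (trA j q) jq) => -> /eqP; lra.
have [[q2 [i2 e2]]|no2] := pselect (exists q, A i q != 0 /\ A j q = - A i q); last first.
  right; exists 1; first by left.
  move=> q iq jq; have : A j q != - A i q by apply/eqP => e; apply: no2; exists q.
  by case: (tern_neq0 (trA i q) iq) => ->; case: (tern_neq0 (trA j q) jq) => -> /eqP; lra.
left=> q.
have h12 : `|A i q1 * A j q2 - A i q2 * A j q1| = 2.
  rewrite e1 e2.
  case: (tern_neq0 (trA i q1) i1) => ->; case: (tern_neq0 (trA i q2) i2) => ->.
  - by rewrite (_ : _ - _ = -2) ?normrN ?normr_nat//; lra.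
  - by rewrite (_ : _ - _ = 2) ?normr_nat//; lra.
  - by rewrite (_ : _ - _ = 2) ?normr_nat//; lra.
  - by rewrite (_ : _ - _ = -2) ?normrN ?normr_nat//; lra.
have n12 : A i q1 * A j q2 - A i q2 * A j q1 != 0.
  by rewrite -normr_eq0 h12 pnatr_eq0.
have key : `|A i q * A j q1 - A i q1 * A j q| != 1.
  apply/eqP => h1.
  have := @tee_minor2 r n A i j q q1 q1 q2 teA.
  rewrite /= h12 h1 -normr_eq0 h1 oner_eq0 => /(_ isT n12).
  by move/eqP; rewrite eq_sym (eqr_nat _ 2 1).
move: key; rewrite e1.
case/or3P: (trA i q) => /eqP->; case/or3P: (trA j q) => /eqP->;
  rewrite ?eqxx ?oner_eq0 ?oppr_eq0 ?oner_eq0// ?mul0r ?mulr0 ?mul1r ?mulr1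
  ?mulN1r ?mulrN1 ?subr0 ?sub0r ?opprK ?normrN;
  by case: (tern_neq0 (trA i q1) i1) => ->; rewrite ?normrN normr1 eqxx.
Qed.

Lemma row_free_dep r n (A : 'M[R]_(r, n)) (y : 'rV[R]_r) : row_free A ->
  (forall q, \sum_j y 0 j * A j q = 0) -> y = 0.
Proof.
move=> fA h; apply: (row_free_inj fA); apply/matrixP => i q.
by rewrite mul0mx !mxE ord1 h.
Qed.

Lemma row_free_neq r n (A : 'M[R]_(r, n)) i j s : row_free A -> i != j ->
  ~ (forall q, A i q = s * A j q).
Proof.
move=> fA ij h.
have /row_free_dep : row_free A by [].
move=> /(_ (\row_k ((k == i)%:R - s *+ (k == j)))) => /(_ _)/rowP/(_ i).
rewrite !mxE eqxx (negbTE ij) mulr0n subr0 => /(_ _)/eqP; rewrite oner_eq0.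
suff k q : \sum_j0 (\row_k ((k == i)%:R - s *+ (k == j))) 0 j0 * A j0 q = 0.
  by move/(_ k).
rewrite (eq_bigr (fun k => (k == i)%:R * A k q - (k == j)%:R * (s * A k q))).
  rewrite sumrB (bigD1 i)//= eqxx mul1r big1 ?addr0; last first.
    by move=> k /negbTE->; rewrite mul0r.
  rewrite (bigD1 j)//= eqxx mul1r big1 ?addr0 ?h ?subrr//.
  by move=> k /negbTE->; rewrite mul0r.
by move=> k _; rewrite !mxE mulrBl; case: (k == j); rewrite ?mulr1n ?mulr0n ?mul1r ?mul0r.
Qed.

Lemma row_neq0 r n (A : 'M[R]_(r, n)) i : row_free A -> exists q, A i q != 0.
Proof.
move=> fA; apply: contrapT => h.
have /row_free_dep : row_free A by [].
move=> /(_ (delta_mx 0 i)) H.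
have /rowP/(_ i) : delta_mx 0 i = 0 :> 'rV[R]_r.
  apply: H => q; apply: big1 => j _; rewrite mxE eqxx /=.
  have [->|] := eqVneq j i; last by rewrite mul0r.
  by rewrite mul1r; apply/eqP/negPn/negP => hq; apply: h; exists q.
by rewrite !mxE !eqxx => /eqP; rewrite oner_eq0.
Qed.

(* For a matrix with entries 0, 1, -1: half the sum of the rows [i], [j], [t] is
   an integer vector. *)
Definition triangle r n (A : 'M[R]_(r, n)) (i j t : 'I_r) :=
  forall q, (A i q != 0) (+) (A j q != 0) (+) (A t q != 0) = false.

Lemma sign_sqr (s : R) : s = 1 \/ s = -1 -> s * s = 1.
Proof. by case=> ->; lra. Qed.

Lemma triangle_tripled r n (A : 'M[R]_(r, n)) (i : 'I_3 -> 'I_r) j t :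
  tee A -> tern_mx A -> row_free A -> injective i ->
  (forall k, par A (i k) (i 0)) -> ~ par A (i 0) j -> ~ par A (i 0) t ->
  ~ triangle A (i 0) j t.
Proof.
move=> teA trA fA inji pari nj nt tri.
have coh l k : ~ par A (i 0) l -> {s : R | (s = 1 \/ s = -1) /\
    forall q, A (i k) q != 0 -> A l q != 0 -> A (i k) q = s * A l q}.
  move=> nl; apply: cid.
  have [pl|[s s1 hs]] := @par_or_coherent r n A (i k) l teA trA.
    by case: nl; apply: par_trans pl; apply: par_sym.
  exists s; split=> // q q1 q2; rewrite (hs q q1 q2) mulrA.
  by rewrite sign_sqr// mul1r.
pose s k := sval (coh j k nj); pose u k := sval (coh t k nt).
have [k [l [kl e]]] : exists k l : 'I_3, k != l /\ s k * u k = s l * u l.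
  have su k : s k * u k = 1 \/ s k * u k = -1.
    rewrite /s /u; case: (coh j k nj) => /= a [[->|->] _];
    by case: (coh t k nt) => /= b [[->|->] _]; rewrite ?mulN1r ?mul1r ?opprK; auto.
  by case: (su 0) => e0; case: (su 1) => e1; case: (su (inord 2)) => e2;
    first [exists 0, 1; split; [by []|by rewrite e0 e1]
          |exists 0, (inord 2); split;
            [by rewrite -(inj_eq val_inj) /= inordK|by rewrite e0 e2]
          |exists 1, (inord 2); split;
            [by rewrite -(inj_eq val_inj) /= inordK|by rewrite e1 e2]].
have s1 m : s m = 1 \/ s m = -1 by rewrite /s; case: (coh j m nj) => /= a [].
have u1 m : u m = 1 \/ u m = -1 by rewrite /u; case: (coh t m nt) => /= a [].
apply: (@row_free_neq r n A (i k) (i l) (s k * s l) fA); first by rewrite (inj_eq inji).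
move=> q.
have [i0|i0] := eqVneq (A (i 0) q) 0.
  have z m : A (i m) q = 0 by apply/eqP; rewrite pari i0.
  by rewrite !z mulr0.
have iq m : A (i m) q != 0 by rewrite pari.
have := tri q; rewrite i0.
have [jq|jq] := eqVneq (A j q) 0; have [tq|tq] := eqVneq (A t q) 0 => //= _.
- have hu m : A (i m) q = u m * A t q.
    by rewrite /u; case: (coh t m nt) => /= a [_]; apply.
  rewrite !hu mulrA; congr (_ * _).
  have := e; case: (s1 k) => ->; case: (s1 l) => ->; case: (u1 k) => ->; case: (u1 l) => ->; lra.
- have hs m : A (i m) q = s m * A j q.
    by rewrite /s; case: (coh j m nj) => /= a [_]; apply.
  by rewrite !hs mulrA -(mulrA (s k)) sign_sqr// mulr1.
Qed.

Lemma triangle_two_doubled r n (A : 'M[R]_(r, n)) i1 i2 j1 j2 t :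
  tee A -> tern_mx A -> row_free A -> i1 != i2 -> j1 != j2 ->
  par A i1 i2 -> par A j1 j2 ->
  ~ par A i1 j1 -> ~ par A i1 t -> ~ par A j1 t -> ~ triangle A i1 j1 t.
Proof.
move=> teA trA fA i12 j12 pi pj nij nit njt tri.
have coh i l : ~ par A i l -> exists2 s : R, s = 1 \/ s = -1 &
    forall q, A i q != 0 -> A l q != 0 -> A i q = s * A l q.
  move=> nl.
  have [//|[s s1 hs]] := @par_or_coherent r n A i l teA trA.
  exists s => // q q1 q2; rewrite (hs q q1 q2) mulrA.
  by rewrite sign_sqr// mul1r.
have ni2t : ~ par A i2 t by move=> h; apply: nit; apply: par_trans h.
have nj2t : ~ par A j2 t by move=> h; apply: njt; apply: par_trans h.
have ni2j1 : ~ par A i2 j1 by move=> h; apply: nij; apply: par_trans h.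
have ni1j2 : ~ par A i1 j2.
  by move=> h; apply: nij; apply: par_trans h (par_sym pj).
have [s1 s1e hs1] := coh _ _ nit.
have [s2 s2e hs2] := coh _ _ ni2t.
have [u1 u1e hu1] := coh _ _ njt.
have [u2 u2e hu2] := coh _ _ nj2t.
have [m1 m1e hm1] := coh _ _ nij.
have [m2 m2e hm2] := coh _ _ ni2j1.
have [k2 k2e hk2] := coh _ _ ni1j2.
have dep1 : m1 * m2 = - (s1 * s2).
  suff : m1 * m2 <> s1 * s2.
    by case: m1e => ->; case: m2e => ->; case: s1e => ->; case: s2e => -> //; lra.
  move=> e; apply: (@row_free_neq r n A i1 i2 (s1 * s2) fA i12) => q.
  have [z1|z1] := eqVneq (A i1 q) 0.
    by have /eqP-> : A i2 q == 0; rewrite -?pi z1 ?mulr0.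
  have z2 : A i2 q != 0 by rewrite -pi.
  have := tri q; rewrite z1.
  have [jq|jq] := eqVneq (A j1 q) 0; have [tq|tq] := eqVneq (A t q) 0 => //= _.
  - rewrite hs1// hs2// mulrA -(mulrA s1) sign_sqr// mulr1//.
  - by rewrite -e hm1// hm2// mulrA -(mulrA m1) sign_sqr// mulr1.
have dep2 : m1 * k2 = - (u1 * u2).
  suff : m1 * k2 <> u1 * u2.
    by case: m1e => ->; case: k2e => ->; case: u1e => ->; case: u2e => -> //; lra.
  move=> e; apply: (@row_free_neq r n A j1 j2 (u1 * u2) fA j12) => q.
  have [z1|z1] := eqVneq (A j1 q) 0.
    by have /eqP-> : A j2 q == 0; rewrite -?pj z1 ?mulr0.
  have z2 : A j2 q != 0 by rewrite -pj.
  have := tri q; rewrite z1.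
  have [iq|iq] := eqVneq (A i1 q) 0; have [tq|tq] := eqVneq (A t q) 0 => //= _.
  - rewrite hu1// hu2// mulrA -(mulrA u1) sign_sqr// mulr1//.
  - have h1 := hm1 q iq z1; have h2 := hk2 q iq z2.
    rewrite -e -mulrA -h2 h1 mulrA sign_sqr// mul1r//.
have /row_free_dep : row_free A by [].
pose y : 'rV[R]_r := \row_k (2 *+ (k == t) - s1 *+ (k == i1) - s2 *+ (k == i2)
   - u1 *+ (k == j1) - u2 *+ (k == j2)).
move=> /(_ y) H.
have ti1 : t != i1 by apply/eqP => e; apply: nit; rewrite e; exact: par_refl.
have ti2 : t != i2 by apply/eqP => e; apply: ni2t; rewrite e; exact: par_refl.
have tj1 : t != j1 by apply/eqP => e; apply: njt; rewrite e; exact: par_refl.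
have tj2 : t != j2 by apply/eqP => e; apply: nj2t; rewrite e; exact: par_refl.
suff /H/rowP/(_ t) : forall q, \sum_j y 0 j * A j q = 0.
  rewrite !mxE eqxx (negbTE ti1) (negbTE ti2) (negbTE tj1) (negbTE tj2) /=.
  by rewrite !mulr0n !subr0 => /eqP; rewrite pnatr_eq0.
move=> q.
have d (a : R) (l : 'I_r) : \sum_j (a *+ (j == l)) * A j q = a * A l q.
  rewrite (bigD1 l)//= eqxx mulr1n big1 ?addr0// => k /negbTE->.
  by rewrite mulr0n mul0r.
rewrite (eq_bigr (fun k => (2 *+ (k == t)) * A k q - (s1 *+ (k == i1)) * A k q
  - (s2 *+ (k == i2)) * A k q - (u1 *+ (k == j1)) * A k q
  - (u2 *+ (k == j2)) * A k q)); last by move=> k _; rewrite mxE !mulrBl.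
rewrite !sumrB !d.
have := tri q.
have [iq|iq] := eqVneq (A i1 q) 0; have [jq|jq] := eqVneq (A j1 q) 0;
  have [tq|tq] := eqVneq (A t q) 0 => //= _.
- have /eqP i2q : A i2 q == 0 by rewrite -pi iq.
  have /eqP j2q : A j2 q == 0 by rewrite -pj jq.
  by rewrite iq jq i2q j2q tq !mulr0 !subr0.
- have /eqP i2q : A i2 q == 0 by rewrite -pi iq.
  have j2q : A j2 q != 0 by rewrite -pj.
  rewrite iq i2q hu1// hu2// !mulr0 !subr0 !mulrA !sign_sqr//; lra.
- have /eqP j2q : A j2 q == 0 by rewrite -pj jq.
  have i2q : A i2 q != 0 by rewrite -pi.
  rewrite jq j2q hs1// hs2// !mulr0 !subr0 !mulrA !sign_sqr//; lra.
- have i2q : A i2 q != 0 by rewrite -pi.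
  have j2q : A j2 q != 0 by rewrite -pj.
  have h1 := hm1 q iq jq; have h2 := hm2 q i2q jq; have h3 := hk2 q iq j2q.
  have h4 : A j2 q = k2 * A i1 q by rewrite h3 mulrA sign_sqr// mul1r.
  rewrite tq h4 h1 h2.
  have e1 : s1 * m1 + s2 * m2 = 0.
    by move: dep1; case: m1e => ->; case: m2e => ->; case: s1e => ->; case: s2e => ->; lra.
  have e2 : u1 + u2 * k2 * m1 = 0.
    by move: dep2; case: m1e => ->; case: k2e => ->; case: u1e => ->; case: u2e => ->; lra.
  have -> : 2 * 0 - s1 * (m1 * A j1 q) - s2 * (m2 * A j1 q) - u1 * A j1 q -
    u2 * (k2 * (m1 * A j1 q)) = - ((s1 * m1 + s2 * m2) + (u1 + u2 * k2 * m1)) * A j1 q by ring.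
  by rewrite e1 e2; ring.
Qed.

End Rows.

(** * Rigidity of a matrix whose rows have equal support *)

Section Block.
Variable R : archiRealFieldType.

Definition pm (x : R) := x = 1 \/ x = -1.

Lemma pm_neq0 x : pm x -> x != 0.
Proof. by case=> ->; rewrite ?oppr_eq0 oner_eq0. Qed.

Lemma left_inv_unit s (M E : 'M[R]_s) : M *m E = 1%:M ->
  E \in unitmx /\ invmx E = M.
Proof.
move=> h; have [_ uE] := mulmx1_unit h; split=> //.
by rewrite -[LHS]mul1mx -h mulmxK.
Qed.

Lemma row_free_colsub s n (B : 'M[R]_(s, n)) : row_free B ->
  exists g : 'I_s -> 'I_n, colsub g B \in unitmx.
Proof.
move=> fB; have fT : row_full B^T by rewrite /row_full mxrank_tr.
exists (fullrankfun fT); rewrite -unitmx_tr.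
suff -> : (colsub (fullrankfun fT) B)^T = rowsub (fullrankfun fT) B^T.
  exact: fullrowsub_unit.
by apply/matrixP => i j; rewrite !mxE.
Qed.

Variables (s n : nat) (B : 'M[R]_(s, n)) (w : 'rV[R]_n).
Hypothesis teX : tee (col_mx w B).
Hypothesis freeX : row_free (col_mx w B).
Hypothesis ternB : tern_mx B.
Hypothesis ternw : tern_mx w.
Hypothesis suppB : forall i q, (B i q == 0) = (w 0 q == 0).
Hypothesis lat4 : forall b, lat B b -> forall i, 4 * b 0 i \is a Num.int.
Variable q : 'rV[R]_s.
Hypothesis latq : lat B q.
Hypothesis q_odd : forall i, 2 * q 0 i \isn't a Num.int.
Hypothesis latS : forall b, lat B b ->
  (forall i, 2 * b 0 i \is a Num.int) \/ (forall i, 2 * b 0 i \isn't a Num.int).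

Let teB : tee B.
Proof.
move=> k p f g.
have e h : mxsub p h B = mxsub (fun x => rshift 1 (p x)) h (col_mx w B).
  by apply/matrixP => i j; rewrite [LHS]mxE [RHS]mxE col_mxEd.
by rewrite !e; apply: teX.
Qed.

Definition cosgn (g : 'I_s -> 'I_n) (c i : 'I_s) : R := 4 * invmx (colsub g B) c i.

Lemma cosgnl g c x : colsub g B \in unitmx ->
  \sum_i cosgn g c i * B i (g x) = 4 * (c == x)%:R.
Proof.
move=> uE; have /matrixP/(_ c x) := mulVmx uE; rewrite [RHS]mxE => <-.
by rewrite mxE mulr_sumr; apply: eq_bigr => i _; rewrite mulrA mxE.
Qed.

Lemma cosgnr g i j : colsub g B \in unitmx ->
  \sum_x B i (g x) * cosgn g x j = 4 * (i == j)%:R.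
Proof.
move=> uE; have /matrixP/(_ i j) := mulmxV uE; rewrite [RHS]mxE => <-.
by rewrite mxE mulr_sumr; apply: eq_bigr => x _; rewrite !mxE mulrCA.
Qed.

Lemma cosgn_uniq g (M : 'I_s -> 'I_s -> R) :
  (forall c x, \sum_i M c i * B i (g x) = 4 * (c == x)%:R) ->
  colsub g B \in unitmx /\ forall c i, cosgn g c i = M c i.
Proof.
move=> hM.
have n4 : (4 : R) != 0 by rewrite pnatr_eq0.
have /left_inv_unit[uE eE] : (\matrix_(c, i) (M c i / 4)) *m colsub g B = 1%:M.
  apply/matrixP => c x; rewrite [RHS]mxE; apply: (mulfI n4).
  rewrite -hM mxE mulr_sumr; apply: eq_bigr => i _.
  by rewrite !mxE mulrA (mulrC 4) divfK.
by split=> // c i; rewrite /cosgn eE mxE mulrC divfK.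
Qed.

Lemma lat_dual g c : colsub g B \in unitmx -> lat B (row c (invmx (colsub g B))).
Proof.
move=> uE; apply: (tee_lat teB (g := g)) => // x.
have -> : (row c (invmx (colsub g B)) *m B) 0 (g x) = (1%:M : 'M[R]_s) c x.
  by rewrite -(mulVmx uE) !mxE; apply: eq_bigr => i _; rewrite !mxE.
by rewrite mxE natr_int.
Qed.

Lemma cosgn_int g c i : colsub g B \in unitmx -> cosgn g c i \is a Num.int.
Proof. by move=> uE; have := lat4 (lat_dual c uE) i; rewrite mxE. Qed.

Lemma cosgn_norm g c c' i : colsub g B \in unitmx ->
  cosgn g c i != 0 -> cosgn g c' i != 0 -> `|cosgn g c i| = `|cosgn g c' i|.
Proof.
move=> uE.
have e x : cosgn g x i = 4 * (\det (colsub g B))^-1 * (-1) ^+ (i + x) *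
    \det (mxsub (lift i) (g \o lift x) B).
  rewrite /cosgn /invmx uE !mxE /cofactor !mulrA; congr (_ * \det _).
  by apply/matrixP => a b; rewrite !mxE.
rewrite !e !mulf_eq0 !negb_or => /andP[_ h] /andP[_ h'].
by rewrite !normrM (teB h h') !normrX !normrN normr1 !expr1n.
Qed.

Lemma cosgn_tern g c i : colsub g B \in unitmx -> tern (cosgn g c i).
Proof.
move=> uE.
have [x0 x0n] : exists x, cosgn g x i != 0.
  apply: contrapT => h; have := cosgnr i i uE; rewrite eqxx mulr1.
  rewrite big1 => [/eqP|x _]; first by rewrite eq_sym pnatr_eq0.
  have [->|z] := eqVneq (cosgn g x i) 0; rewrite ?mulr0//.
  by case: h; exists x.
set f := cosgn g x0 i in x0n.
have mult x : exists2 e, cosgn g x i = e * f & tern e.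
  have [->|z] := eqVneq (cosgn g x i) 0.
    by exists 0; rewrite ?mul0r// /tern eqxx.
  exists (cosgn g x i / f); first by rewrite divfK.
  by rewrite tern_norm normf_div (cosgn_norm uE z x0n) divff ?eqxx ?orbT ?normr_eq0.
have /intrP[k ek] : f \is a Num.int by exact: cosgn_int.
have [m em] : exists m : int, 4 = f * m%:~R.
  have := cosgnr i i uE; rewrite eqxx mulr1 => <-.
  have /intrP[m hm] : \sum_x B i (g x) * (cosgn g x i / f) \is a Num.int.
    apply: rpred_sum => x _; apply: rpredM; first exact/tern_int/ternB.
    by have [e -> te] := mult x; rewrite mulfK// tern_int.
  exists m; rewrite -hm mulr_sumr; apply: eq_bigr => x _.
  by rewrite [RHS]mulrCA [f * _]mulrC divfK.
have [m' em'] : exists m : int, 4 * q 0 i = f * m%:~R.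
  have eq0 : q = (colsub g (q *m B)) *m invmx (colsub g B).
    by rewrite -[LHS](mulmxK uE); congr (_ *m _); apply/matrixP => a b;
      rewrite !mxE; apply: eq_bigr => z _; rewrite !mxE.
  have /intrP[m0 hm] : \sum_x (q *m B) 0 (g x) * (cosgn g x i / f) \is a Num.int.
    apply: rpred_sum => x _; apply: rpredM; first exact: latq.
    by have [e -> te] := mult x; rewrite mulfK// tern_int.
  exists m0; rewrite -hm mulr_sumr {1}eq0 mxE mulr_sumr; apply: eq_bigr => x _.
  by rewrite [colsub _ _ _ _]mxE mulrCA -/(cosgn g x i) [RHS]mulrCA [f * _]mulrC divfK.
have km : 4 = k * m.
    have : (4%:Z)%:~R = (k * m)%:~R :> R by rewrite intrM -ek -em.
  by move/intr_inj.
have kodd : odd `|k|%N.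
  apply/negPn/negP => ke; have [k' hk'] : exists k', k = 2 * k'.
    by exists (k %/ 2)%Z; lia.
  apply/negP: (q_odd i); rewrite negbK; apply/intrP; exists (k' * m').
  apply: (mulfI (_ : (2 : R) != 0)); first by rewrite pnatr_eq0.
  by rewrite mulrA -natrM em' ek hk' !intrM mulrA.
have k1 : k = 1 \/ k = -1.
  have : (`|k| %| 4)%N by apply/dvdnP; exists `|m|%N; lia.
  move: kodd; have : (`|k| <= 4)%N.
    by apply: dvdn_leq => //; apply/dvdnP; exists `|m|%N; lia.
  by case: k {ek km} => [[|[|[|[|[|]]]]]|[|[|[|[|]]]]] //=; [left|right].
have [e -> te] := mult c.
by rewrite ek; case: k1 => ->; case/or3P: te => /eqP->;
  rewrite /tern ?mul0r ?mul1r ?mulN1r ?opprK ?eqxx ?orbT.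
Qed.

Lemma cosgn_pm g c i : colsub g B \in unitmx -> pm (cosgn g c i).
Proof.
move=> uE; apply: (tern_neq0 (cosgn_tern c i uE)).
have half x : 2 * (row c (invmx (colsub g B))) 0 x = cosgn g c x / 2.
  by rewrite mxE /cosgn; lra.
case: (latS (lat_dual c uE)) => H; last first.
  by apply/eqP => z; have := H i; rewrite half z mul0r rpred0.
have z x : cosgn g c x = 0.
  have := H x; rewrite half.
  have := cosgn_tern c x uE; case/or3P => /eqP-> //; rewrite ?mul1r ?mulN1r ?rpredN;
  by rewrite (negbTE (half_notint R)).
have := cosgnl c c uE; rewrite big1 => [|x _]; last by rewrite z mul0r.
by rewrite eqxx mulr1 => /eqP; rewrite eq_sym pnatr_eq0.
Qed.

Lemma basis_col_pm g i x : colsub g B \in unitmx -> pm (B i (g x)).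
Proof.
move=> uE; apply: tern_neq0; first exact: ternB.
apply/negP => z; have := cosgnl x x uE; rewrite big1 => [|j _].
  by rewrite eqxx mulr1 => /eqP; rewrite eq_sym pnatr_eq0.
suff /eqP-> : B j (g x) == 0 by rewrite mulr0.
by move: z; rewrite !suppB.
Qed.

Lemma basis_w_pm g (i x : 'I_s) : colsub g B \in unitmx -> pm (w 0 (g x)).
Proof.
move=> uE; apply: tern_neq0; first exact: ternw.
by rewrite -(suppB i); apply/pm_neq0/basis_col_pm.
Qed.

(* A column that is a combination of two or more basis columns could replace
   one of them, and would then give a dual vector with even entries. *)
Lemma single_support g h (t : 'cV[R]_s) c d : colsub g B \in unitmx ->
  (forall x, tern (t x 0)) -> (forall i, B i h = \sum_x B i (g x) * t x 0) ->
  t c 0 != 0 -> t d 0 != 0 -> c = d.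
Proof.
move=> uE tt eh tc td; apply/eqP/negPn/negP => cd.
pose g' x := if x == c then h else g x.
pose M x i := if x == c then cosgn g c i / t c 0
  else cosgn g x i - t x 0 / t c 0 * cosgn g c i.
have ch x : \sum_i cosgn g x i * B i h = 4 * t x 0.
  rewrite (eq_bigr (fun i => \sum_y cosgn g x i * B i (g y) * t y 0)); last first.
    by move=> i _; rewrite eh mulr_sumr; apply: eq_bigr => y _; rewrite mulrA.
  rewrite exchange_big (bigD1 x)//= -mulr_suml cosgnl// eqxx mulr1.
  rewrite [X in _ + X]big1 ?addr0// => y yx.
  by rewrite -mulr_suml cosgnl// eq_sym (negbTE yx) mulr0 mul0r.
have [uE' eM] : colsub g' B \in unitmx /\ forall x i, cosgn g' x i = M x i.
  apply: cosgn_uniq => x y; rewrite /M /g'.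
  have [->|xc] := eqVneq x c.
    rewrite (eq_bigr (fun i => (t c 0)^-1 * (cosgn g c i * B i (if y == c then h else g y)))).
      rewrite -mulr_sumr; case: (eqVneq y c) => [_|yc].
        by rewrite ch mulrCA mulVf.
      by rewrite cosgnl// (eq_sym c) (negbTE yc) !mulr0.
    by move=> i _; rewrite mulrA (mulrC _^-1).
  rewrite (eq_bigr (fun i => cosgn g x i * B i (if y == c then h else g y) -
      t x 0 / t c 0 * (cosgn g c i * B i (if y == c then h else g y)))).
    rewrite sumrB -mulr_sumr; case: (eqVneq y c) => [->|yc].
      by rewrite !ch (negbTE xc) mulrCA divfK// subrr mulr0.
    by rewrite !cosgnl// (eq_sym c) (negbTE yc) !mulr0 subr0.
  by move=> i _; rewrite mulrBl mulrA.
have i0 : 'I_s := c.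
have := cosgn_pm d i0 uE'; rewrite eM /M eq_sym (negbTE cd).
have := cosgn_pm d i0 uE; have := cosgn_pm c i0 uE.
case: (tern_neq0 (tt c) tc) => ->; case: (tern_neq0 (tt d) td) => ->;
  by case=> ->; case=> ->; case; rewrite ?divr1 ?invrN1; lra.
Qed.

Lemma extra_value g h c0 c1 tau i : colsub g B \in unitmx -> c1 != c0 -> pm tau ->
  (forall j, B j h = tau * B j (g c0)) -> w 0 h = - (tau * w 0 (g c0)) ->
  let y := \sum_c cosgn g c i * w 0 (g c) in y = 0 \/ `|y| = 2.
Proof.
move=> uE c10 ptau eB ew y.
have [y0|y0] := eqVneq y 0; [by left | right].
pose p j := if j == i then lshift s 0 else rshift 1 j : 'I_(1 + s).
pose D := mxsub p g (col_mx w B).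
have eD j c : D j c = if j == i then w 0 (g c) else B j (g c).
  by rewrite mxE /p; case: (j == i); rewrite ?col_mxEu ?col_mxEd.
have uD : D \in unitmx.
  have dE : \det (colsub g B) != 0 by move: uE; rewrite unitmxE unitfE.
  rewrite unitmxE unitfE (@det_row_repl _ _ (colsub g B) D (colsub g w) i); last first.
    by move=> a b; rewrite eD !mxE.
  rewrite (_ : _ 0 i = \det (colsub g B) * (y / 4)); last first.
    rewrite -[RHS]mulr1.
    rewrite mxE /y /cosgn /invmx uE mulr_suml mulr_sumr.
    rewrite mulr1; apply: eq_bigr => c _; rewrite !mxE; field; exact: dE.
  by rewrite !mulf_neq0// invr_eq0 pnatr_eq0.
have [t tt et] := tee_coef h teX uD.
pose t' : 'cV[R]_s := \col_c (tau * ((c == c0)%:R - 2 * w 0 (g c0) / y * cosgn g c i)).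
have tt' : t = t'.
  have : D *m t = D *m t'.
    apply/colP => j; rewrite !mxE.
    have -> : \sum_x D j x * t x 0 = (col_mx w B) (p j) h.
      by rewrite et; apply: eq_bigr => x _; rewrite [D _ _]mxE.
    have -> : \sum_x D j x * t' x 0 =
       tau * D j c0 - tau * (2 * w 0 (g c0) / y) * \sum_x D j x * cosgn g x i.
      rewrite mulr_sumr (eq_bigr (fun x => (tau * D j x) *+ (x == c0)
         - tau * (2 * w 0 (g c0) / y) * (D j x * cosgn g x i))); last first.
        by move=> x _; rewrite [t' _ _]mxE; case: (x == c0); rewrite ?mulr1n ?mulr0n; ring.
      rewrite sumrB; congr (_ - _); rewrite (bigD1 c0)//= eqxx mulr1n big1 ?addr0//.
      by move=> x /negbTE->; rewrite mulr0n.
    rewrite /p eD; have [ji|ji] := eqVneq j i.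
      rewrite col_mxEu ew (_ : \sum_x _ = y).
        by rewrite mulrA divfK//; ring.
      by apply: eq_bigr => x _; rewrite eD ji eqxx mulrC.
    rewrite col_mxEd eB (_ : \sum_x _ = 0) ?mulr0 ?subr0//.
    transitivity (\sum_x B j (g x) * cosgn g x i).
      by apply: eq_bigr => x _; rewrite eD (negbTE ji).
    by rewrite cosgnr// (negbTE ji) mulr0.
  by move=> /(congr1 (mulmx (invmx D))); rewrite !mulKmx.
have := tt c1; rewrite tt' mxE (negbTE c10) sub0r.
have := cosgn_pm c1 i uE; move: (cosgn g c1 i) => F pc.
have pw := basis_w_pm i c0 uE.
have n1 x : pm x -> `|x| = 1 by case=> ->; rewrite ?normrN normr1.
rewrite tern_norm !normrM normrN !normrM normfV (n1 _ ptau) (n1 _ pc) (n1 _ pw).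
rewrite !mul1r !mulr1 normr_nat mulf_eq0 invr_eq0 pnatr_eq0 normr_eq0 (negbTE y0) /=.
by move=> /eqP/(canRL (divfK _))->; rewrite ?normr_eq0// mul1r.
Qed.

Lemma free_B : row_free B.
Proof.
apply: inj_row_free => v vB.
have := row_free_inj freeX
  (_ : row_mx 0 v *m col_mx w B = row_mx 0 0 *m col_mx w B).
by rewrite !mul_row_col !mul0mx vB addr0 => /(_ erefl)/eq_row_mx[].
Qed.

Lemma block_rigid : (0 < s)%N -> False.
Proof.
move=> s0; pose i0 := Ordinal s0.
have [g uE] := row_free_colsub free_B.
pose sg x := w 0 (g x).
have psg x : pm (sg x) by exact: basis_w_pm i0 x uE.
have pF c i : pm (cosgn g c i) by exact: cosgn_pm.
have pB i x : pm (B i (g x)) by exact: basis_col_pm.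
pose la := colsub g w *m invmx (colsub g B).
have [h hh] : exists h, w 0 h != (la *m B) 0 h.
  apply: contrapT => hn.
  have : row_mx 1%:M (- la) *m col_mx w B = row_mx 0 0 *m col_mx w B.
    rewrite !mul_row_col !mul0mx mul1mx mulNmx addr0; apply/eqP; rewrite subr_eq0.
    apply/eqP/matrixP => i j; rewrite ord1; apply/eqP/negPn/negP => hj.
    by apply: hn; exists j.
  move=> /(row_free_inj freeX)/eq_row_mx[/matrixP/(_ 0 0)]; rewrite !mxE => /eqP.
  by rewrite oner_eq0.
have [t tt et] : exists2 t : 'cV[R]_s, (forall c, tern (t c 0)) &
    forall i, B i h = \sum_c B i (g c) * t c 0 by exact: (tee_coef (p := id)).
have lah : (la *m B) 0 h = \sum_c sg c * t c 0.
  have -> : (la *m B) 0 h = (la *m (colsub g B *m t)) 0 0.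
    rewrite !mxE; apply: eq_bigr => i _; congr (_ * _).
    by rewrite et mxE; apply: eq_bigr => x _; rewrite !mxE.
  by rewrite mulmxA mulmxKV// mxE; apply: eq_bigr => x _; rewrite !mxE.
have [c0 tc0] : exists c, t c 0 != 0.
  apply: contrapT => hn.
  have t0 c : t c 0 = 0 by apply/eqP/negPn/negP => hc; apply: hn; exists c.
  move: hh; rewrite lah big1 => [|x _]; last by rewrite t0 mulr0.
  by rewrite -(suppB i0) et big1 ?eqxx// => x _; rewrite t0 mulr0.
have tz c : c != c0 -> t c 0 = 0.
  move=> cc; apply/eqP/negPn/negP => hc; move: cc.
  by rewrite (single_support uE tt et hc tc0) eqxx.
pose tau := t c0 0.
have ptau : pm tau := tern_neq0 (tt c0) tc0.
have eh j : B j h = tau * B j (g c0).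
  rewrite et (bigD1 c0)//= big1 ?addr0 1?mulrC// => x xc.
  by rewrite tz// mulr0.
have ew : w 0 h = - (tau * w 0 (g c0)).
  have : pm (w 0 h).
    apply: tern_neq0; first exact: ternw.
    by rewrite -(suppB i0) eh mulf_neq0 ?pm_neq0.
  move: hh; rewrite lah (bigD1 c0)//= big1 ?addr0 => [|x xc]; last by rewrite tz ?mulr0.
  rewrite -/tau -/(sg c0); case: ptau => ->; case: (psg c0) => ->; move=> h1;
  by case=> e; move: h1; rewrite e; rewrite ?mulr1 ?mulrN1 ?mulN1r ?opprK ?eqxx//; lra.
have [c1 c10] : exists c1, c1 != c0.
  apply: contrapT => hn; have := cosgnr i0 i0 uE; rewrite eqxx mulr1 (bigD1 c0)//= big1.
    rewrite addr0; case: (pB i0 c0) => ->; case: (pF c0 i0) => ->; lra.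
  by move=> x xc; case: hn; exists x.
pose y i := \sum_c cosgn g c i * sg c.
have ty i : y i = 0 \/ `|y i| = 2 by exact: extra_value c10 ptau eh ew.
(* the basis in which the other column with the same restriction replaces [g c0] *)
pose g' x := if x == c0 then h else g x.
pose M c i := if c == c0 then tau * cosgn g c i else cosgn g c i.
have [uE' eM] : colsub g' B \in unitmx /\ forall x i, cosgn g' x i = M x i.
  apply: cosgn_uniq => c x; rewrite /M /g'.
  have [->|cc] := eqVneq c c0; have [ex|xc] := eqVneq x c0.
  - transitivity (\sum_i cosgn g c0 i * B i (g c0)); last by rewrite cosgnl// eqxx.
    by apply: eq_bigr => i _; rewrite eh mulrACA sign_sqr// mul1r.
  - rewrite mulr0 (eq_bigr (fun i => tau * (cosgn g c0 i * B i (g x)))).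
      by rewrite -mulr_sumr cosgnl// eq_sym (negbTE xc) !mulr0.
    by move=> i _; rewrite mulrA.
  - rewrite ex (negbTE cc) mulr0 (eq_bigr (fun i => tau * (cosgn g c i * B i (g c0)))).
      by rewrite -mulr_sumr cosgnl// (negbTE cc) !mulr0.
    by move=> i _; rewrite eh mulrCA.
  - by rewrite cosgnl.
pose y' i := \sum_c cosgn g' c i * w 0 (g' c).
have ty' i : y' i = 0 \/ `|y' i| = 2.
  apply: (@extra_value g' (g c0) c0 c1 tau i uE' c10 ptau) => [j|].
    by rewrite /g' eqxx eh mulrA sign_sqr// mul1r.
  by rewrite /g' eqxx ew mulrN opprK mulrA sign_sqr// mul1r.
have yy' i : y' i = y i - 2 * (cosgn g c0 i * sg c0).
  rewrite /y' /y (bigD1 c0)//= [in RHS](bigD1 c0)//= eM /M eqxx {1}/g' eqxx ew.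
  rewrite (_ : tau * cosgn g c0 i * - (tau * w 0 (g c0)) = - (cosgn g c0 i * sg c0)).
    rewrite (eq_bigr (fun c => cosgn g c i * sg c)); first by ring.
    by move=> x xc; rewrite eM /M /g' (negbTE xc).
  rewrite /sg; have := sign_sqr ptau => e.
  by rewrite mulrN mulrACA e mul1r.
have mod4 i j : (y i - y j) / 4 \is a Num.int.
  have [->|ij] := eqVneq i j; first by rewrite subrr mul0r rpred0.
  have e4 : \sum_c (cosgn g c i - cosgn g c j) * B i (g c) = 4.
    have := cosgnr i i uE; have := cosgnr i j uE.
    rewrite eqxx (negbTE ij) mulr0 mulr1 => e1 e2.
    rewrite -[RHS]subr0 -{2}e1 -{1}e2 -sumrB; apply: eq_bigr => c _; ring.
  have -> : y i - y j = 4 + \sum_c (cosgn g c i - cosgn g c j) * (sg c - B i (g c)).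
    rewrite -{1}e4 /y -sumrB -big_split; apply: eq_bigr => c _ /=; ring.
  rewrite mulrDl divff ?pnatr_eq0// rpredD ?rpred1// mulr_suml.
  apply: rpred_sum => c _.
  have -> : (cosgn g c i - cosgn g c j) * (sg c - B i (g c)) / 4 =
     ((cosgn g c i - cosgn g c j) / 2) * ((sg c - B i (g c)) / 2) by field.
  have hp (a b : R) : pm a -> pm b -> (a - b) / 2 \is a Num.int.
    by case=> ->; case=> ->; rewrite ?subrr ?mul0r ?rpred0//;
      [rewrite (_ : _ / _ = 1) ?rpred1|rewrite (_ : _ / _ = -1) ?rpredN ?rpred1]; lra.
  by rewrite rpredM// hp.
have big x : `|x| = 2 :> R -> x = 2 \/ x = -2.
  move=> /eqP; rewrite eqr_norml => /andP[/orP[]/eqP-> _]; [by left|by right].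
have z0 i j : y i = 0 -> y j = 0.
  move=> yi; case: (ty j) => // /big; have := mod4 i j; rewrite yi sub0r.
  move=> hi [] e; move: hi; rewrite e ?opprK.
  - by rewrite mulNr rpredN (_ : 2 / 4 = 2^-1) ?(negbTE (half_notint R))//; lra.
  - by rewrite (_ : 2 / 4 = 2^-1) ?(negbTE (half_notint R))//; lra.
have nz (f : 'I_s -> 'I_n) : colsub f B \in unitmx ->
    (forall i, \sum_c cosgn f c i * w 0 (f c) = 0) -> False.
  move=> uf hf; have := pm_neq0 (basis_w_pm i0 i0 uf); suff -> : w 0 (f i0) = 0 by rewrite eqxx.
  have : colsub f w *m invmx (colsub f B) = 0.
    apply/matrixP => a i; rewrite ord1 !mxE; apply: (mulfI (_ : (4 : R) != 0)).
      by rewrite pnatr_eq0.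
    rewrite mulr0 mulr_sumr; transitivity (\sum_c cosgn f c i * w 0 (f c)); last exact: hf.
    by apply: eq_bigr => c _; rewrite !mxE /cosgn; ring.
  move=> /(congr1 (mulmx^~ (colsub f B))); rewrite mulmxKV// mul0mx.
  by move=> /matrixP/(_ 0 i0); rewrite !mxE.
have [yi0|yi0] := ty i0; first by apply: (nz g) => // i; exact: z0 yi0.
apply: (nz g') => // i; rewrite -/(y' i).
have yi : `|y i| = 2.
  by case: (ty i) => // yi; have := z0 i i0 yi => e; move: yi0; rewrite e normr0 => e2; lra.
have := ty' i; rewrite yy' => -[//|/big h1]; case: (big _ yi) => e; move: h1; rewrite e;
  by case: (pF c0 i) => ->; case: (psg c0) => ->; rewrite ?mulr1 ?mulN1r ?mul1r ?mulrN1 ?opprK; case; lra.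
Qed.

End Block.

(** * Contraction of a row *)

Section Contraction.
Variable R : archiRealFieldType.

Lemma rowsub_free r n (A : 'M[R]_(r, n)) s (p : 'I_s -> 'I_r) :
  injective p -> row_free A -> row_free (rowsub p A).
Proof.
move=> pi /row_freeP[D AD]; apply/row_freeP; exists (colsub p D).
apply/matrixP => i j; have /matrixP/(_ (p i) (p j)) := AD.
rewrite !mxE (inj_eq pi) => <-.
by apply: eq_bigr => k _; rewrite !mxE.
Qed.

Variables (r n : nat) (A : 'M[R]_(r.+1, n)) (t : 'I_r.+1) (p : 'I_n).

Definition kap (i : 'I_r) : R := if `[< par A (lift t i) t >] then 2 else 1.

Definition ctr : 'M[R]_(r, n) := \matrix_(i, j) ((kap i)^-1 * pivot A t p i j).

Definition down (c : 'rV[R]_r.+1) : 'rV[R]_r := \row_i (kap i * c 0 (lift t i)).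

Definition up (c : 'rV[R]_r) : 'rV[R]_r.+1 :=
  \row_j oapp (fun i => c 0 i / kap i)
    (- \sum_i c 0 i / kap i * (A (lift t i) p / A t p)) (unlift t j).

Hypothesis teA : tee A.
Hypothesis trA : tern_mx A.
Hypothesis fA : row_free A.
Hypothesis tp0 : A t p != 0.

Lemma kap_neq0 i : kap i != 0.
Proof. by rewrite /kap; case: ifP; rewrite ?pnatr_eq0 ?oner_eq0. Qed.

Lemma kap1 i : ~ par A (lift t i) t -> kap i = 1.
Proof. by rewrite /kap => /asboolPn/negbTE->. Qed.

Lemma kap2 i : par A (lift t i) t -> kap i = 2.
Proof. by rewrite /kap => /asboolP->. Qed.

Lemma ctr_tee : tee ctr. Proof. exact/tee_scale/tee_pivot. Qed.

Lemma upE c i : up c 0 (lift t i) = c 0 i / kap i.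
Proof. by rewrite mxE liftK. Qed.

Lemma up_ctr c : up c *m A = c *m ctr.
Proof.
apply/rowP => q; rewrite !mxE (bigD1_ord t)//= mxE unlift_none /=.
rewrite mulNr mulr_suml -sumrN -big_split; apply: eq_bigr => i _ /=.
by rewrite upE !mxE; ring.
Qed.

Lemma lat_up c : lat ctr c -> lat A (up c).
Proof. by move=> lc j; rewrite up_ctr. Qed.

Lemma lat_down c : lat A c -> lat ctr (down c).
Proof.
move=> lc j.
have -> : (down c *m ctr) 0 j = (c *m A) 0 j - A t j / A t p * (c *m A) 0 p.
  rewrite [in RHS]mxE [X in _ - _ * X]mxE (bigD1_ord t)//= [X in _ - _ * X](bigD1_ord t)//=.
  rewrite mulrDr mulrCA divfK// opprD addrACA subrr add0r mulr_sumr -sumrB mxE.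
  apply: eq_bigr => i _; rewrite !mxE mulrACA divff ?kap_neq0//; ring.
apply: rpredB => //; apply: rpredM => //.
by case: (tern_neq0 (trA t p) tp0) => ->; rewrite ?invrN1 ?invr1 ?mulrN1 ?mulr1
  ?rpredN; exact: tern_int.
Qed.

Lemma ctr_free : row_free ctr.
Proof.
apply: inj_row_free => v vz.
have /(row_free_inj fA) : up v *m A = 0 *m A by rewrite up_ctr vz mul0mx.
move=> /rowP h; apply/rowP => i; have := h (lift t i); rewrite upE !mxE => /eqP.
by rewrite mulf_eq0 invr_eq0 (negbTE (kap_neq0 i)) orbF => /eqP.
Qed.

Lemma ctrE i q : ctr i q = (kap i)^-1 *
  (A (lift t i) q - A (lift t i) p / A t p * A t q).
Proof. by rewrite !mxE. Qed.

Lemma ctr_nonpar i q : ~ par A (lift t i) t ->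
  tern (ctr i q) /\ (ctr i q != 0) =
    (A (lift t i) q != 0) (+) ((A (lift t i) p != 0) && (A t q != 0)).
Proof.
move=> nit; rewrite ctrE kap1// invr1 mul1r.
have [//|[s s1 hs]] := par_or_coherent (lift t i) t teA trA.
have [->|ip] := eqVneq (A (lift t i) p) 0.
  by rewrite !mul0r subr0 /= addbF; split=> //; exact: trA.
have e : A (lift t i) p / A t p = s.
  rewrite (hs p ip tp0) invfM mulrCA divff// mulr1.
  by case: s1 => ->; rewrite ?invr1 ?invrN1.
rewrite e.
have [zi|zi] := eqVneq (A (lift t i) q) 0.
  rewrite zi sub0r oppr_eq0 mulf_eq0 negb_or /=.
  by case: s1 => ->; rewrite ?oppr_eq0 oner_eq0 /= ?mul1r ?mulN1r ?opprK;
    split=> //; rewrite ?tern_norm ?normrN -?tern_norm; exact: trA.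
have [zt|zt] := eqVneq (A t q) 0.
  by rewrite zt mulr0 subr0 zi; split=> //; exact: trA.
rewrite (hs q zi zt) mulrA.
by case: s1 => ->; rewrite ?mulN1r ?mul1r ?opprK ?mul1r subrr eqxx /tern eqxx.
Qed.

Lemma ctr_par i q : par A (lift t i) t ->
  tern (ctr i q) /\
  (ctr i q != 0 -> ctr i q = - (A (lift t i) p / A t p) * A t q).
Proof.
move=> pit; rewrite ctrE kap2//.
have pm1 x y : A x y != 0 -> A x y = 1 \/ A x y = -1 by apply: tern_neq0.
have ip : A (lift t i) p != 0 by rewrite pit.
have [zt|zt] := eqVneq (A t q) 0.
  have /eqP zi : A (lift t i) q == 0 by rewrite pit zt.
  by rewrite zi zt mulr0 subrr mulr0 eqxx /tern eqxx.
have zi : A (lift t i) q != 0 by rewrite pit.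
case: (pm1 _ _ zi) => ->; case: (pm1 _ _ zt) => ->;
case: (pm1 _ _ ip) => ->; case: (pm1 _ _ tp0) => ->;
rewrite ?invrN1 ?invr1 ?mulrN1 ?mulr1 ?mulN1r ?opprK ?mul1r ?subrr ?mulr0 ?eqxx /tern ?eqxx//;
rewrite ?addNr ?mulr0 ?eqxx//; rewrite ?addrN ?mulr0 ?eqxx//;
rewrite -?opprD ?mulrN (_ : 2^-1 * (1 + 1) = 1) ?eqxx ?orbT//; lra.
Qed.

Lemma ctr_tern : tern_mx ctr.
Proof.
move=> i q; have [/ctr_par|/ctr_nonpar] := pselect (par A (lift t i) t).
  by move=> /(_ q)[].
by move=> /(_ q)[].
Qed.

End Contraction.

(** * Coordinates of lattice points *)

Section Structure.
Variable R : archiRealFieldType.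

Definition qclass r n (A : 'M[R]_(r, n)) (i : 'I_r) : {set 'I_r} :=
  [set j | `[< par A i j /\
     forall c, lat A c -> 2 * (c 0 i - c 0 j) \is a Num.int >]].

Lemma qclassP r n (A : 'M[R]_(r, n)) i j : reflect (par A i j /\
     forall c, lat A c -> 2 * (c 0 i - c 0 j) \is a Num.int) (j \in qclass A i).
Proof. by rewrite inE; exact: asboolP. Qed.

Lemma int_quarter (x : R) : 4 * x \is a Num.int -> 2 * x \isn't a Num.int ->
  2 * x - 2^-1 \is a Num.int.
Proof.
move=> h1 h2; have [] // : 2 * x \is a Num.int \/ 2 * x - 2^-1 \is a Num.int.
  by apply: int_halfP; rewrite mulrA -natrM.
by rewrite (negbTE h2).
Qed.

Lemma tern_opp (x y : R) : tern x -> tern y -> (x == 0) = (y == 0) -> x <> y ->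
  (x = 1 \/ x = -1) /\ y = - x.
Proof.
move=> tx ty xy nxy; have x0 : x != 0.
  by apply/eqP => x0; apply: nxy; apply/eqP; rewrite x0 eq_sym -xy x0.
have y0 : y != 0 by rewrite -xy.
split; first exact: tern_neq0.
move: nxy; case: (tern_neq0 tx x0) => ->; case: (tern_neq0 ty y0) => -> //;
by rewrite ?opprK.
Qed.

Lemma triangle_tripled_set r n (A : 'M[R]_(r, n)) (S : {set 'I_r}) i j t :
  tee A -> tern_mx A -> row_free A -> (2 < #|S|)%N ->
  (forall k, k \in S -> par A k i) -> ~ par A i j -> ~ par A i t ->
  ~ triangle A i j t.
Proof.
move=> teA trA fA /card_gt2P[x [y [z [[xS yS zS] [xy yz zx]]]]] pari nj nt tri.
have uq : uniq [tuple x; y; z] by rewrite /= !inE negb_or xy eq_sym zx yz.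
have pk k : par A (tnth [tuple x; y; z] k) i.
  by apply: pari; have := mem_tnth k [tuple x; y; z]; rewrite !inE => /or3P[]/eqP->.
have p0 := pk 0.
apply: (@triangle_tripled R r n A (tnth [tuple x; y; z]) j t teA trA fA).
- exact/tuple_uniqP.
- by move=> k; apply: par_trans (pk k) _; apply: par_sym.
- by move=> h; apply: nj; apply: par_trans h; apply: par_sym.
- by move=> h; apply: nt; apply: par_trans h; apply: par_sym.
- by move=> q; rewrite p0; exact: tri.
Qed.

(* In the contraction by [t] two rows of a class could only become parallel
   through a triangle with [t], which a class of size at least 4 rules out. *)
Lemma par_of_ctr r n (A : 'M[R]_(r.+1, n)) t p i (K : {set 'I_r}) :
  tee A -> tern_mx A -> row_free A -> A t p != 0 -> i \in K -> (3 < #|K|)%N ->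
  (forall k, k \in K -> ~ par A (lift t k) t) ->
  (forall k, k \in K -> par (ctr A t p) i k) ->
  forall k, k \in K -> par A (lift t i) (lift t k).
Proof.
move=> teA trA fA tp iK K3 nK pK k kK; apply: contrapT => nik.
have dich a b : a \in K -> b \in K ->
    if (A (lift t a) p != 0) == (A (lift t b) p != 0)
    then par A (lift t a) (lift t b) else triangle A (lift t a) (lift t b) t.
  move=> aK bK.
  have ab q : (ctr A t p a q != 0) = (ctr A t p b q != 0).
    by rewrite -(pK a aK q) -(pK b bK q).
  have H q : (A (lift t a) q != 0) (+) ((A (lift t a) p != 0) && (A t q != 0))
     = (A (lift t b) q != 0) (+) ((A (lift t b) p != 0) && (A t q != 0)).
    rewrite -(ctr_nonpar teA trA tp q (nK a aK)).2.
    by rewrite -(ctr_nonpar teA trA tp q (nK b bK)).2 ab.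
  case: ifP => e q; have := H q.
    rewrite (eqP e) => /(congr1 (addb^~ ((A (lift t b) p != 0) && (A t q != 0)))).
    by rewrite !addbK => /negb_inj.
  move: e; case: (A (lift t a) p != 0); case: (A (lift t b) p != 0) => //= _;
  by case: (_ == 0); case: (_ == 0); case: (_ == 0).
pose a0 := (A (lift t i) p != 0).
pose S1 := [set x in K | (A (lift t x) p != 0) == a0].
pose S2 := [set x in K | (A (lift t x) p != 0) != a0].
have kS2 : k \in S2.
  rewrite inE kK; apply/negP => e; apply: nik.
  by have := dich i k iK kK; rewrite eq_sym e.
have tik : triangle A (lift t i) (lift t k) t.
  have := dich i k iK kK; by case: ifP => [_ /nik|].
have tki : triangle A (lift t k) (lift t i) t.
  by move=> q; rewrite (addbC (A (lift t k) q != 0)); exact: tik.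
have c12 : (#|S1| + #|S2| = #|K|)%N.
  rewrite -(cardsID [set x | (A (lift t x) p != 0) == a0] K).
  by congr (_ + _)%N; apply: eq_card => x; rewrite !inE andbC.
have imS (S : {set 'I_r}) : #|[set lift t x | x in S]| = #|S|.
  by apply: card_imset; exact: lift_inj.
have p1 x : x \in S1 -> par A (lift t x) (lift t i).
  by rewrite inE => /andP[xK e]; have := dich x i xK iK; rewrite e.
have p2 x : x \in S2 -> par A (lift t x) (lift t k).
  rewrite inE => /andP[xK e]; have := dich x k xK kK.
  suff -> : (A (lift t x) p != 0) == (A (lift t k) p != 0) by [].
  move: e kS2; rewrite inE => e /andP[_]; move: e.
  by move: (a0) (_ != 0) (_ != 0) => [] [] [].
have [s1|s1] := ltnP 2 #|S1|.
  apply: (@triangle_tripled_set r.+1 n A [set lift t x | x in S1]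
    (lift t i) (lift t k) t teA trA fA) => //; first by rewrite imS.
  - by move=> _ /imsetP[x xS ->]; exact: p1.
  - exact: nK.
have [s2|s2] := ltnP 2 #|S2|.
  apply: (@triangle_tripled_set r.+1 n A [set lift t x | x in S2]
    (lift t k) (lift t i) t teA trA fA) => //; first by rewrite imS.
  - by move=> _ /imsetP[x xS ->]; exact: p2.
  - by move=> /par_sym.
  - exact: nK.
have /card_gt1P[x1 [x2 [x1S x2S x12]]] : (1 < #|S1|)%N by lia.
have /card_gt1P[y1 [y2 [y1S y2S y12]]] : (1 < #|S2|)%N by lia.
have q1 := p1 _ x1S; have q2 := p1 _ x2S; have q3 := p2 _ y1S; have q4 := p2 _ y2S.
apply: (@triangle_two_doubled R r.+1 n A (lift t x1) (lift t x2) (lift t y1)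
   (lift t y2) t teA trA fA).
- by rewrite (inj_eq (@lift_inj _ _)).
- by rewrite (inj_eq (@lift_inj _ _)).
- exact: par_trans q1 (par_sym q2).
- exact: par_trans q3 (par_sym q4).
- by move=> h; apply: nik; apply: par_trans (par_trans (par_sym q1) h) q3.
- by apply: nK; move: x1S; rewrite inE => /andP[].
- by apply: nK; move: y1S; rewrite inE => /andP[].
- by move=> q; rewrite q1 q3; exact: tik.
Qed.

Lemma all_par_rigid r n (A : 'M[R]_(r, n)) : tee A -> tern_mx A -> row_free A ->
  (forall i j, par A i j) ->
  (forall c, lat A c -> forall i, 4 * c 0 i \is a Num.int) ->
  forall c, lat A c -> (forall i, 2 * c 0 i \is a Num.int) \/
    (forall i, 2 * c 0 i \isn't a Num.int).
Proof.
move=> teA trA fA pA A4.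
pose S (c : 'rV[R]_r) := [set i | 2 * c 0 i \isn't a Num.int].
pose P (X : {set 'I_r}) := `[< X != set0 /\ exists2 c, lat A c & S c = X >].
suff key X : P X -> (forall Y, P Y -> #|X| <= #|Y|)%N -> X = setT.
  move=> c lc; have [S0|Sn] := eqVneq (S c) set0.
    left=> i; apply/negPn/negP => ni; have : i \in S c by rewrite inE.
    by rewrite S0 inE.
  have PS : P (S c) by apply/asboolP; split=> //; exists c.
  case: (arg_minnP (fun X : {set 'I_r} => #|X|) PS) => X PX minX.
  have XT := key X PX minX; right=> i; have := minX _ PS.
  rewrite XT cardsT => h; have : S c == setT by rewrite eqEcard subsetT cardsT.
  by move=> /eqP/setP/(_ i); rewrite !inE.
move=> /asboolP[X0 [cs lcs eX]] minX; apply/eqP; rewrite -subTset.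
apply/subsetP => e _; apply/negPn/negP => eX'.
have X0' : (0 < #|X|)%N by rewrite card_gt0.
pose B := rowsub (fun k : 'I_#|X| => enum_val k) A.
pose ext (b : 'rV[R]_#|X|) : 'rV[R]_r :=
  b *m rowsub (fun k : 'I_#|X| => enum_val k) 1%:M.
have extA b : ext b *m A = b *m B.
  by rewrite /ext -mulmxA mul_rowsub_mx mul1mx.
have extE b k : ext b 0 (enum_val k) = b 0 k.
  rewrite mxE (bigD1 k)//= !mxE eqxx mulr1 big1 ?addr0// => l lk.
  by rewrite !mxE (inj_eq enum_val_inj) (negbTE lk) mulr0.
have ext0 b j : j \notin X -> ext b 0 j = 0.
  move=> jX; rewrite mxE big1// => k _; rewrite !mxE.
  case: eqP => [ej|]; last by rewrite mulr0.
  by move: jX; rewrite -ej enum_valP.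
have latext b : lat B b -> lat A (ext b) by move=> lb j; rewrite extA.
pose rho (x : 'I_(1 + #|X|)) := match split x with inl _ => e | inr k => enum_val k end.
have rhoL k : rho (lshift _ k) = e.
  by rewrite /rho; have /= -> := unsplitK (inl k : 'I_1 + 'I_#|X|).
have rhoR k : rho (rshift _ k) = enum_val k.
  by rewrite /rho; have /= -> := unsplitK (inr k : 'I_1 + 'I_#|X|).
have rhoE : col_mx (row e A) B = rowsub rho A.
  apply/matrixP => x j; rewrite [RHS]mxE.
  case: (split_ordP x) => k ->; first by rewrite col_mxEu rhoL mxE.
  by rewrite col_mxEd rhoR mxE.
have rho_inj : injective rho.
  move=> x y; case: (split_ordP x) => k ->; case: (split_ordP y) => l ->;
    rewrite ?rhoL ?rhoR.
  - by rewrite !ord1.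
  - by move=> ee; move: eX'; rewrite ee enum_valP.
  - by move=> ee; move: eX'; rewrite -ee enum_valP.
  - by move=> /enum_val_inj->.
pose k0 : 'I_#|X| := Ordinal X0'.
pose tau := \sum_(j | j \notin X) cs 0 j.
pose q : 'rV[R]_#|X| := \row_k (cs 0 (enum_val k) + tau *+ (k == k0)).
have ntau : 2 * tau \is a Num.int.
  rewrite mulr_sumr; apply: rpred_sum => j; rewrite -eX inE => /negPn//.
have lq : lat B q.
  move=> j.
  have -> : (q *m B) 0 j = (cs *m A) 0 j +
      \sum_(i | i \notin X) cs 0 i * (A (enum_val k0) j - A i j).
    rewrite [LHS]mxE [X in X + _]mxE (bigID (fun i => i \in X))//= -addrA -big_split /=.
    rewrite (eq_bigr (fun k => cs 0 (enum_val k) * A (enum_val k) j +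
       (tau *+ (k == k0)) * A (enum_val k) j)); last first.
      by move=> k _; rewrite !mxE mulrDl.
    rewrite big_split /=; congr (_ + _).
      by rewrite [RHS]big_enum_val.
    rewrite (bigD1 k0)//= ?eqxx mulr1n big1 ?addr0; last first.
      by move=> k /negbTE->; rewrite mulr0n mul0r.
    by rewrite mulr_suml; apply: eq_bigr => i _; ring.
  apply: rpredD; first exact: lcs.
  apply: rpred_sum => i iX.
  have ci : 2 * cs 0 i \is a Num.int by move: iX; rewrite -eX inE => /negPn.
  have [m m1 ->] : exists2 m, m \is a Num.int & A (enum_val k0) j - A i j = 2 * m.
    have := pA i (enum_val k0) j.
    case/or3P: (trA (enum_val k0) j) => /eqP->; case/or3P: (trA i j) => /eqP->;
      rewrite ?eqxx ?oppr_eq0 ?oner_eq0// => _;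
      by [exists 0; rewrite ?rpred0//; lra|exists 1; rewrite ?rpred1//; lra
         |exists (-1); rewrite ?rpredN ?rpred1//; lra].
  by rewrite mulrA (mulrC _ 2); exact: rpredM.
apply: (@block_rigid R #|X| n B (row e A) _ _ _ _ _ _ q) => //.
- by rewrite rhoE; exact: tee_rowsub.
- by rewrite rhoE; exact: rowsub_free.
- by move=> i j; rewrite mxE; exact: trA.
- by move=> i j; rewrite mxE; exact: trA.
- by move=> i j; rewrite !mxE; exact: pA.
- by move=> b lb i; rewrite -extE; apply/A4/latext.
- move=> i; rewrite mxE mulrDr; apply/negP => h.
  have : enum_val i \in S cs by rewrite eX enum_valP.
  rewrite inE => /negP; apply.
  rewrite -[2 * _](addrK (2 * (tau *+ (i == k0)))); apply: rpredB => //.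
  by case: (i == k0); rewrite ?mulr1n ?mulr0n ?mulr0 ?rpred0.
- move=> b lb; have [S0|Sn] := eqVneq (S (ext b)) set0.
    left=> i; rewrite -extE; apply/negPn/negP => ni.
    have : enum_val i \in S (ext b) by rewrite inE.
    by rewrite S0 inE.
  right=> i; rewrite -extE.
  have PS : P (S (ext b)) by apply/asboolP; split=> //; exists (ext b) => //; exact: latext.
  have : S (ext b) == X.
    rewrite eqEcard minX// andbT; apply/subsetP => j; rewrite inE.
    by apply: contraR => /ext0->; rewrite mulr0 rpred0.
  by move=> /eqP/setP/(_ (enum_val i)); rewrite enum_valP inE.
Qed.

Lemma odd_column_even r n (A : 'M[R]_(r, n)) c i : tern_mx A -> row_free A ->
  (forall i j, par A i j) -> lat A c ->
  (forall i, 2 * c 0 i - 2^-1 \is a Num.int) -> (i < r)%N -> ~~ odd r.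
Proof.
move=> trA fA pA lc cq ir; apply: (@odd_half_int R).
have [q hq] := row_neq0 (Ordinal ir) fA.
have -> : r%:R / 2 = 2 * (c *m A) 0 q - \sum_j (2 * (c 0 j * A j q) - 2^-1).
  rewrite sumrB -mulr_sumr mxE subKr big_const_ord iter_addr_0.
  by rewrite mulr_natl.
apply: rpredB; first by rewrite rpredM ?natr_int.
apply: rpred_sum => j _.
have jq : A j q != 0 by rewrite (pA j (Ordinal ir)).
case: (tern_neq0 (trA j q) jq) => ->; first by rewrite mulr1.
rewrite (_ : _ - _ = - (2 * c 0 j - 2^-1) - 1) ?rpredB ?rpredN ?rpred1//; lra.
Qed.

Theorem te_structure r n (A : 'M[R]_(r, n)) : tee A -> tern_mx A -> row_free A ->
  (forall c, lat A c -> forall i, 4 * c 0 i \is a Num.int) /\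
  (forall c, lat A c -> forall i, 2 * c 0 i \isn't a Num.int ->
     ~~ odd #|qclass A i| /\ (3 < #|qclass A i|)%N).
Proof.
elim: r A => [|r IH] A teA trA fA; first by split=> c _ [].
have A4 c : lat A c -> forall i, 4 * c 0 i \is a Num.int.
  move=> lc i; have [[t nit]|npar] := pselect (exists t, ~ par A i t).
    have ti : t != i by apply/eqP => ti; apply: nit; rewrite ti; exact: par_refl.
    have [i' ei _] := unlift_some ti; rewrite ei in nit *.
    have [p tp] := row_neq0 t fA.
    have [I4 _] := IH _ (ctr_tee teA tp) (ctr_tern teA trA tp) (ctr_free t p fA).
    by have := I4 _ (lat_down trA tp lc) i'; rewrite mxE kap1// mul1r.
  have pA j k : par A j k.
    have pi l : par A i l by apply: contrapT => h; apply: npar; exists l.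
    exact: par_trans (par_sym (pi j)) (pi k).
  case: r IH A teA trA fA c lc i npar pA => [|r] IH A teA trA fA c lc i npar pA.
    have [q hq] := row_neq0 i fA; have := lc q; rewrite mxE big_ord1 ord1.
    rewrite [i]ord1 in hq.
    move=> h; have h1 : c 0 0 \is a Num.int.
      by move: h; case: (tern_neq0 (trA _ _) hq) => ->; rewrite ?mulr1 ?mulrN1 ?rpredN.
    by rewrite [i]ord1 rpredM ?natr_int.
  pose t := lift i ord0.
  have ti : t != i by rewrite eq_sym neq_lift.
  have [i' ei _] := unlift_some ti; rewrite ei.
  have [p tp] := row_neq0 t fA.
  have fM := ctr_free t p fA.
  have [I4 I2] := IH _ (ctr_tee teA tp) (ctr_tern teA trA tp) fM.
  have := I2 _ (lat_down trA tp lc) i'; rewrite mxE kap2//.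
  case: (boolP (2 * (2 * c 0 (lift t i')) \is a Num.int)) => [h _|_ /(_ isT)[_ h]].
    by move: h; rewrite mulrA -natrM.
  have [j jQ ji] : exists2 j, j \in qclass (ctr A t p) i' & j != i'.
    have /card_gt1P[x [y [xQ yQ xy]]] : (1 < #|qclass (ctr A t p) i'|)%N by lia.
    have [xi|xi] := eqVneq x i'; last by exists x.
    by exists y => //; rewrite -xi eq_sym.
  case/qclassP: jQ => pij _; case: (@row_free_neq R r.+1 n (ctr A t p) j i'
    ((A (lift t j) p / A t p) * (A (lift t i') p / A t p)) fM ji) => q.
  have [zi|zi] := eqVneq (ctr A t p i' q) 0.
    by rewrite zi mulr0; apply/eqP; rewrite -pij zi.
  have zj : ctr A t p j q != 0 by rewrite -pij.
  have [_ ->] := ctr_par trA tp q (pA (lift t j) t); last by [].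
  have [_ ->] := ctr_par trA tp q (pA (lift t i') t); last by [].
  have : A (lift t i') p / A t p * (A (lift t i') p / A t p) = 1.
    have ip : A (lift t i') p != 0 by rewrite (pA _ t).
    by case: (tern_neq0 (trA _ _) ip) => ->; case: (tern_neq0 (trA _ _) tp) => ->;
      rewrite ?invrN1 ?invr1; lra.
  move: (A (lift t i') p / A t p) (A (lift t j) p / A t p) => a b e.
  by rewrite mulrA mulrN -[b * a * a]mulrA e mulr1.
split=> // c lc i ci.
have [[t nit]|npar] := pselect (exists t, ~ par A i t).
  have ti : t != i by apply/eqP => ti; apply: nit; rewrite ti; exact: par_refl.
  have [i' ei _] := unlift_some ti; rewrite ei in nit ci *.
  have [p tp] := row_neq0 t fA.
  have [I4 I2] := IH _ (ctr_tee teA tp) (ctr_tern teA trA tp) (ctr_free t p fA).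
  have ci' : 2 * (down A t c) 0 i' \isn't a Num.int by rewrite mxE kap1// mul1r.
  have [Qodd Q3] := I2 _ (lat_down trA tp lc) i' ci'.
  suff -> : qclass A (lift t i') = [set lift t x | x in qclass (ctr A t p) i'].
    by rewrite card_imset//; exact: lift_inj.
  have nK k : k \in qclass (ctr A t p) i' -> ~ par A (lift t k) t.
    move=> /qclassP[_ h] pkt; have := h _ (lat_down trA tp lc).
    rewrite !mxE kap1// kap2// mul1r mulrBr => h1; move: ci => /negP; apply.
    have -> : 2 * c 0 (lift t i') = 2 * c 0 (lift t i') - 2 * (2 * c 0 (lift t k))
       + 4 * c 0 (lift t k) by lra.
    by rewrite rpredD// A4.
  have iQ : i' \in qclass (ctr A t p) i'.
    by apply/qclassP; split=> [|d _]; [exact: par_refl|rewrite subrr mulr0 rpred0].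
  have pk := par_of_ctr teA trA fA tp iQ Q3 nK
    (fun k kQ => (qclassP _ _ _ kQ).1).
  apply/setP => j; apply/idP/imsetP => [/qclassP[pij hj]|[k kQ ->]].
    have tj : t != j by apply/eqP => tj; apply: nit; move=> q; rewrite pij -tj.
    have [j' ej _] := unlift_some tj; exists j' => //; rewrite ej in pij hj.
    have njt : ~ par A (lift t j') t by move=> h; apply: nit; exact: par_trans pij h.
    apply/qclassP; split=> [q|d ld].
      apply: negb_inj; rewrite (ctr_nonpar teA trA tp q nit).2.
      by rewrite (ctr_nonpar teA trA tp q njt).2 !pij.
    by have := hj _ (lat_up ld); rewrite !upE !kap1// !divr1.
  apply/qclassP; split; first exact: pk.
  move=> d ld; case/qclassP: (kQ) => _ /(_ _ (lat_down trA tp ld)).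
  by rewrite !mxE !kap1 ?mul1r//; exact: nK.
have pA j k : par A j k.
  have pi l : par A i l by apply: contrapT => h; apply: npar; exists l.
  exact: par_trans (par_sym (pi j)) (pi k).
have rigid := all_par_rigid teA trA fA pA A4.
have ch j : 2 * c 0 j \isn't a Num.int.
  by case: (rigid c lc) => // h; move: ci; rewrite h.
have cq j : 2 * c 0 j - 2^-1 \is a Num.int by apply: int_quarter => //; exact: A4.
have -> : qclass A i = setT.
  apply/setP => j; rewrite in_setT; apply/qclassP; split=> // d ld.
  rewrite mulrBr; case: (rigid d ld) => h; first exact: rpredB.
  have := rpredB (int_quarter (A4 d ld i) (h i)) (int_quarter (A4 d ld j) (h j)).
  by rewrite opprB addrA subrK.
rewrite cardsT card_ord.
have ev : ~~ odd r.+1 by exact: odd_column_even trA fA pA lc cq (ltn_ord i).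
split=> //; clear IH ci npar i; case: r A teA trA fA A4 c lc pA rigid ch cq ev
  => [|[|[|r]]]// A teA trA fA A4 c lc pA rigid ch cq _.
have [q1 h1] : exists q, A 0 q <> A 1 q.
  apply: contrapT => h; apply: (@row_free_neq R _ _ A 0 1 1 fA) => // q.
  by rewrite mul1r; apply: contrapT => h'; apply: h; exists q.
have [q2 h2] : exists q, A 0 q <> - A 1 q.
  apply: contrapT => h; apply: (@row_free_neq R _ _ A 0 1 (-1) fA) => // q.
  by rewrite mulN1r; apply: contrapT => h'; apply: h; exists q.
have l1 : lift ord0 ord0 = 1 :> 'I_2 by exact/val_inj.
have [pm1 e1] := tern_opp (trA 0 q1) (trA 1 q1) (pA 0 1 q1) h1.
have [pm2 e2] : (A 0 q2 = 1 \/ A 0 q2 = -1) /\ - A 1 q2 = - A 0 q2.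
  apply: tern_opp h2; first exact: trA.
    by rewrite tern_norm normrN -tern_norm.
  by rewrite oppr_eq0; exact: pA.
have := lc q1; have := lc q2; rewrite !mxE !big_ord_recl !big_ord0 !l1 !addr0.
rewrite e1 -[A 1 q2]opprK e2 opprK mulrN -mulrDl -mulrBl => i2 i1.
have c2 : c 0 0 + c 0 1 \is a Num.int.
  by move: i2; case: pm2 => ->; rewrite ?mulr1 ?mulrN1 ?rpredN.
have c1 : c 0 0 - c 0 1 \is a Num.int.
  by move: i1; case: pm1 => ->; rewrite ?mulr1 ?mulrN1 ?rpredN.
have := rpredD c2 c1; rewrite addrACA subrr addr0 => z.
by have := ch 0; rewrite mulr_natl mulr2n z.
Qed.

End Structure.

Section Coordinates.
Variables (R : realType) (r n : nat).
Implicit Types (B : 'M[R]_(r, n)) (x h : 'rV[R]_n) (l : 'cV[R]_n).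

(* Locked, so that [mxE] does not unfold it. *)
Definition coord B x : 'rV[R]_r := locked (x *m pinvmx B).

Lemma coordK B x : (x <= B)%MS -> coord B x *m B = x.
Proof. by rewrite /coord -lock; exact: mulmxKpV. Qed.

Lemma mul_coord B (c : 'rV[R]_r) : row_free B -> coord B (c *m B) = c.
Proof. by move=> fB; rewrite /coord -lock mulmxKp. Qed.

Lemma coordD B x y : coord B (x + y) = coord B x + coord B y.
Proof. by rewrite /coord -!lock mulmxDl. Qed.

Lemma coordB B x y : coord B (x - y) = coord B x - coord B y.
Proof. by rewrite /coord -!lock mulmxBl. Qed.

Lemma coordZ B a x : coord B (a *: x) = a *: coord B x.
Proof. by rewrite /coord -!lock -scalemxAl. Qed.

Lemma coord_row B k : row_free B -> coord B (row k B) = delta_mx 0 k.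
Proof. by move=> fB; rewrite rowE mul_coord. Qed.

Lemma row_coneP B x : row_free B ->
  row_cone B x <-> (x <= B)%MS /\ forall i, 0 <= coord B x 0 i.
Proof.
move=> fB; split=> [[c c0 ->]|[xB x0]].
  by rewrite submxMl mul_coord.
by exists (coord B x) => //; rewrite coordK.
Qed.

Lemma row_cone_row m (B : 'M[R]_(m, n)) k : row_cone B (row k B).
Proof.
exists (delta_mx 0 k); last by rewrite rowE.
by move=> i; rewrite mxE; case: (_ && _); rewrite ?ler01 ?lexx.
Qed.

Lemma row_coneD m (B : 'M[R]_(m, n)) x y :
  row_cone B x -> row_cone B y -> row_cone B (x + y).
Proof.
move=> [c c0 ->] [d d0 ->]; exists (c + d); last by rewrite mulmxDl.
by move=> i; rewrite mxE addr_ge0.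
Qed.

Lemma row_coneZ m (B : 'M[R]_(m, n)) a x : 0 <= a -> row_cone B x -> row_cone B (a *: x).
Proof.
move=> a0 [c c0 ->]; exists (a *: c); last by rewrite scalemxAl.
by move=> i; rewrite mxE mulr_ge0.
Qed.

Lemma row_cone0 m (B : 'M[R]_(m, n)) : row_cone B 0.
Proof. by exists 0; [move=> i; rewrite mxE|rewrite mul0mx]. Qed.

Lemma row_cone_comb m (B : 'M[R]_(m, n)) k (D : 'M[R]_(k, n)) :
  (forall i, row_cone B (row i D)) -> (row_cone D `<=` row_cone B)%classic.
Proof.
move=> h _ [c c0 ->]; rewrite mulmx_sum_row.
elim/big_rec: _ => [|i y _ yB]; first exact: row_cone0.
by apply: row_coneD => //; apply: row_coneZ.
Qed.

Definition lin l x : R := (x *m l) 0 0.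

Lemma linD l x y : lin l (x + y) = lin l x + lin l y.
Proof. by rewrite /lin mulmxDl mxE. Qed.

Lemma linZ l a x : lin l (a *: x) = a * lin l x.
Proof. by rewrite /lin -scalemxAl mxE. Qed.

Lemma lin_sum l m (c : 'rV[R]_m) (B : 'M[R]_(m, n)) :
  lin l (c *m B) = \sum_i c 0 i * lin l (row i B).
Proof.
rewrite /lin -mulmxA mxE; apply: eq_bigr => i _.
by rewrite -row_mul [row _ _ _ _]mxE.
Qed.

Definition replace_row B h i : 'M[R]_(r, n) :=
  \matrix_(k, j) if k == i then h 0 j else B k j.

Lemma row_replace B h i k :
  row k (replace_row B h i) = if k == i then h else row k B.
Proof. by apply/rowP => j; rewrite !mxE; case: ifP; rewrite ?mxE. Qed.

Variables (B : 'M[R]_(r, n)) (h : 'rV[R]_n) (i : 'I_r).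
Hypothesis fB : row_free B.
Hypothesis hB : (h <= B)%MS.
Hypothesis hi : coord B h 0 i != 0.

Let upd (y : 'rV[R]_r) : 'rV[R]_r := \row_j
  if j == i then y 0 i / coord B h 0 i
  else y 0 j - coord B h 0 j * (y 0 i / coord B h 0 i).

Lemma mul_replace (c : 'rV[R]_r) : c *m replace_row B h i =
  (\row_j (if j == i then c 0 i * coord B h 0 i
           else c 0 j + coord B h 0 j * c 0 i)) *m B.
Proof.
rewrite !mulmx_sum_row (bigD1 i)//= [RHS](bigD1 i)//= row_replace eqxx.
rewrite -{1}(coordK hB) mulmx_sum_row (bigD1 i)//= scalerDr scalerA -addrA mxE eqxx.
congr (_ + _); rewrite scaler_sumr -big_split; apply: eq_bigr => j /negbTE ji /=.
by rewrite row_replace mxE ji scalerA scalerDl mulrC addrC.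
Qed.

Lemma replace_row_free : row_free (replace_row B h i).
Proof.
apply: inj_row_free => c; rewrite mul_replace => e.
have /rowP z := row_free_inj fB (etrans e (esym (mul0mx _ B))).
move: (coord B h) hi z => a ai z.
have ci : c 0 i = 0.
  have := z i; rewrite !mxE eqxx => /eqP; rewrite mulf_eq0 (negbTE ai) orbF.
  by move/eqP.
apply/rowP => j; have := z j; rewrite !mxE; case: eqP => [->|_] //.
by rewrite ci mulr0 addr0.
Qed.

Lemma replace_row_eqmx : (replace_row B h i == B)%MS.
Proof.
have sub : (replace_row B h i <= B)%MS.
  apply/row_subP => k; rewrite row_replace; case: ifP => _ //.
  exact: row_sub.
by rewrite -(geq_leqif (mxrank_leqif_eq sub)) (eqP fB) (eqP replace_row_free).
Qed.

Lemma coord_replace x : (x <= B)%MS -> coord (replace_row B h i) x = upd (coord B x).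
Proof.
move=> xB; have e : x = upd (coord B x) *m replace_row B h i.
  rewrite mul_replace -[LHS](coordK xB); congr (_ *m _).
  rewrite /upd; move: (coord B h) (coord B x) hi => a y ai.
  apply/rowP => j; rewrite !mxE eqxx divfK//; case: eqP => [->|_] //.
  by rewrite subrK.
by rewrite {1}e mul_coord ?replace_row_free.
Qed.

End Coordinates.

(** * Stellar subdivision of regular complexes *)

Section Complex.
Variables (R : realType) (r n : nat) (A : 'M[R]_(r, n)).
Implicit Types (B : 'M[R]_(r, n)) (h x : 'rV[R]_n) (P : ('M[R]_(r, n) * 'cV[R]_n)%type).

(* Each maximal cone comes with the linear form that the convex function
   certifying regularity is equal to on it. *)
Definition regular_complex (K : seq ('M[R]_(r, n) * 'cV[R]_n)) :=
  [/\ forall P, P \in K ->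
        [/\ row_free P.1, (P.1 == A)%MS & (row_cone P.1 `<=` row_cone A)%classic],
      forall x, row_cone A x -> exists2 P, P \in K & row_cone P.1 x &
      forall P P' k, P \in K -> P' \in K ->
        lin P.2 (row k P'.1) <= lin P'.2 (row k P'.1) /\
        (lin P.2 (row k P'.1) = lin P'.2 (row k P'.1) ->
         row_cone P.1 (row k P'.1))].

Definition stellar h B B' :=
  (~ row_cone B h /\ B' = B) \/
  (row_cone B h /\ exists2 i, 0 < coord B h 0 i & B' = replace_row B h i).

Lemma regular_complex1 : row_free A -> regular_complex [:: (A, 0)].
Proof.
move=> fA; split.
- by move=> P; rewrite inE => /eqP->; split; rewrite ?submx_refl.
- by move=> x Ax; exists (A, 0); rewrite ?inE.
- move=> P P' k; rewrite !inE => /eqP-> /eqP->; split=> //= _.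
  exact: row_cone_row.
Qed.

Lemma complex_le K P P' x : regular_complex K -> P \in K -> P' \in K ->
  row_cone P'.1 x -> lin P.2 x <= lin P'.2 x /\
  (lin P.2 x = lin P'.2 x <-> row_cone P.1 x).
Proof.
have le Q Q' y : regular_complex K -> Q \in K -> Q' \in K ->
    row_cone Q'.1 y -> lin Q.2 y <= lin Q'.2 y.
  move=> [_ _ h] QK QK' [c c0 ->]; rewrite !lin_sum.
  by apply: ler_sum => k _; apply: ler_wpM2l => //; case: (h Q Q' k).
move=> rK PK PK' xP'; split; first exact: le.
split=> [|xP]; last by apply/eqP; rewrite eq_le !le.
case: rK => _ _ h; case: xP' => c c0 ->; rewrite !lin_sum => /eqP.
rewrite eq_sym -subr_eq0 -sumrB psumr_eq0 => [/allP e|k _]; last first.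
  by rewrite -mulrBr mulr_ge0// subr_ge0; case: (h P P' k).
rewrite mulmx_sum_row; elim/big_ind: _ => [||k _].
- exact: row_cone0.
- exact: row_coneD.
- have [->|ck] := eqVneq (c 0 k) 0; first by rewrite scale0r; exact: row_cone0.
  apply: row_coneZ => //; case: (h P P' k) => // _; apply.
  have := e k (mem_index_enum k); rewrite -mulrBr mulf_eq0 (negbTE ck) /=.
  by rewrite subr_eq0 => /eqP.
Qed.

Lemma small_eps (T : eqType) (L : seq T) (d s : T -> R) : exists2 e, 0 < e &
  forall e', 0 < e' <= e -> forall t, t \in L -> 0 < d t -> 0 < d t + e' * s t.
Proof.
elim: L => [|t L [e e0 he]]; first by exists 1.
have [d0|d0] := leP (d t) 0.
  exists e => // e' /he{}he t'; rewrite inE => /orP[/eqP->|]; last exact: he.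
  by rewrite ltNge d0.
have s0 : 0 < 1 + `|s t| by rewrite ltr_pwDl.
exists (Num.min e (d t / (1 + `|s t|))); first by rewrite lt_min e0 divr_gt0.
move=> e' /andP[e'0]; rewrite le_min => /andP[e'e e'd] t'.
rewrite inE => /orP[/eqP-> _|]; last by apply: he; rewrite e'0.
have : e' * `|s t| < d t.
  rewrite (@le_lt_trans _ _ (d t / (1 + `|s t|) * `|s t|)) ?ler_wpM2r//.
  by rewrite -{2}[d t](divfK (lt0r_neq0 s0)) ltr_pM2l ?divr_gt0// ltrDr.
have : 0 <= e' * (`|s t| + s t).
  apply: mulr_ge0; first exact: ltW.
  by rewrite -lerBlDr sub0r -normrN ler_norm.
by rewrite mulrDr; lra.
Qed.

Definition subdiv h e P : seq ('M[R]_(r, n) * 'cV[R]_n) :=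
  if `[< row_cone P.1 h >] then
    [seq (replace_row P.1 h i,
          P.2 - (e / coord P.1 h 0 i) *: col i (pinvmx P.1))
       | i <- enum 'I_r & 0 < coord P.1 h 0 i]
  else [:: P].

Lemma lin_sub P a i x :
  lin (P.2 - a *: col i (pinvmx P.1)) x = lin P.2 x - a * coord P.1 x 0 i.
Proof.
by rewrite /lin /coord -lock mulmxBr -scalemxAr colE mulmxA -colE !mxE.
Qed.

Lemma subdivP h e P Q : Q \in subdiv h e P ->
  (~ row_cone P.1 h /\ Q = P) \/
  (row_cone P.1 h /\ exists2 i, 0 < coord P.1 h 0 i &
    Q.1 = replace_row P.1 h i /\
    forall x, lin Q.2 x = lin P.2 x - e / coord P.1 h 0 i * coord P.1 x 0 i).
Proof.
rewrite /subdiv; case: asboolP => hP; last by rewrite inE => /eqP->; left.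
case/mapP => i; rewrite mem_filter => /andP[i0 _] ->; right; split=> //.
by exists i => //; split=> // x; rewrite lin_sub.
Qed.

Lemma row_cone_replace B h i x : row_free B -> row_cone B h ->
  0 < coord B h 0 i -> (x <= B)%MS ->
  row_cone (replace_row B h i) x <->
    0 <= coord B x 0 i /\ forall j, j != i ->
      coord B h 0 j * (coord B x 0 i / coord B h 0 i) <= coord B x 0 j.
Proof.
move=> fB hB hi xB; have [hB' h0] := (row_coneP h fB).1 hB.
have hi' : coord B h 0 i != 0 by rewrite gt_eqF.
have fr := replace_row_free fB hB' hi'.
have /andP[_ Br] := replace_row_eqmx fB hB' hi'.
have key j : coord (replace_row B h i) x 0 j = if j == i then
    coord B x 0 i / coord B h 0 i
  else coord B x 0 j - coord B h 0 j * (coord B x 0 i / coord B h 0 i).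
  by rewrite coord_replace// mxE.
split=> [/(row_coneP _ fr)[_ c0]|[xi xj]].
  split; first by have := c0 i; rewrite key eqxx pmulr_lge0 ?invr_gt0.
  by move=> j /negbTE ji; have := c0 j; rewrite key ji subr_ge0.
apply/(row_coneP _ fr); split; first exact: submx_trans xB Br.
move=> j; rewrite key; case: eqP => [_|/eqP ji].
  by rewrite divr_ge0// ltW.
by rewrite subr_ge0 xj.
Qed.

Lemma subdiv_cover h P x : row_free P.1 -> row_cone P.1 h -> h != 0 ->
  row_cone P.1 x -> exists2 i, 0 < coord P.1 h 0 i &
    row_cone (replace_row P.1 h i) x.
Proof.
move=> fP hP hn xP; have [hB h0] := (row_coneP h fP).1 hP.
have [xB x0] := (row_coneP x fP).1 xP.
have [i0 hi0] : exists i, 0 < coord P.1 h 0 i.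
  apply: contrapT => no; move/eqP: hn; apply.
  rewrite -(coordK hB) (_ : coord _ _ = 0) ?mul0mx//; apply/rowP => i.
  rewrite [RHS]mxE; apply/eqP; rewrite eq_le h0 andbT leNgt; apply/negP => hi.
  by apply: no; exists i.
case: (@arg_minP _ _ _ i0 (fun i => 0 < coord P.1 h 0 i)
  (fun i => coord P.1 x 0 i / coord P.1 h 0 i) hi0) => i hi mini.
exists i => //; apply/(row_cone_replace fP hP hi xB); split=> // j ji.
have [hj|hj] := ltP 0 (coord P.1 h 0 j).
  by rewrite mulrC -ler_pdivlMr// mini.
have -> : coord P.1 h 0 j = 0 by apply/eqP; rewrite eq_le hj h0.
by rewrite mul0r.
Qed.

Lemma stellar_complex K h : regular_complex K -> row_cone A h -> h != 0 ->
  exists2 K', regular_complex K' &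
    forall P', P' \in K' -> exists2 P, P \in K & stellar h P.1 P'.1.
Proof.
move=> rK hA hn; have [K1 K2 K3] := rK.
pose L2 := [seq (P, Q) | P <- K, Q <- K].
pose L1 := [seq (PQ, ik) | PQ <- L2, ik <- enum {: 'I_r * 'I_r}].
have [e1 e10 he1] := small_eps L1
  (fun t => lin t.1.2.2 (row t.2.2 t.1.2.1) - lin t.1.1.2 (row t.2.2 t.1.2.1))
  (fun t => coord t.1.1.1 (row t.2.2 t.1.2.1) 0 t.2.1 / coord t.1.1.1 h 0 t.2.1).
have [e2 e20 he2] := small_eps L2 (fun t => lin t.2.2 h - lin t.1.2 h) (fun=> -1).
pose e := Num.min e1 e2.
have e0 : 0 < e by rewrite lt_min e10.
have ee1 : 0 < e <= e1 by rewrite e0 ge_min lexx.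
have ee2 : 0 < e <= e2 by rewrite e0 ge_min lexx orbT.
have E1 P Q i k : P \in K -> Q \in K ->
    lin P.2 (row k Q.1) < lin Q.2 (row k Q.1) ->
    lin P.2 (row k Q.1) - e / coord P.1 h 0 i * coord P.1 (row k Q.1) 0 i
      < lin Q.2 (row k Q.1).
  move=> PK QK lt; rewrite -subr_gt0.
  have inL : ((P, Q), (i, k)) \in L1.
    by apply: allpairs_f; [exact: allpairs_f|exact: mem_enum].
  have := he1 e ee1 _ inL; rewrite /= => /(_ (etrans (subr_gt0 _ _) lt)).
  by congr (0 < _); ring.
have E2 P Q : P \in K -> Q \in K -> lin P.2 h < lin Q.2 h ->
    lin P.2 h < lin Q.2 h - e.
  move=> PK QK lt; rewrite -subr_gt0.
  have inL : (P, Q) \in L2 by exact: allpairs_f.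
  have := he2 e ee2 _ inL; rewrite /= => /(_ (etrans (subr_gt0 _ _) lt)).
  by congr (0 < _); ring.
have spanA P x : P \in K -> row_cone A x -> (x <= P.1)%MS.
  move=> PK [c _ ->]; have [_ /andP[_ AP] _] := K1 P PK.
  exact: submx_trans (submxMl _ _) AP.
have rowA P k : P \in K -> row_cone A (row k P.1).
  by move=> PK; have [_ _ PA] := K1 P PK; apply/PA/row_cone_row.
exists (flatten [seq subdiv h e P | P <- K]); last first.
  move=> P' /flatten_mapP[P PK /subdivP[[nh ->]|[hP [i hi [-> _]]]]]; exists P => //.
    by left.
  by right; split=> //; exists i.
split.
- move=> Q /flatten_mapP[P PK]; have [fP PA PC] := K1 P PK.
  case/subdivP=> [[_ ->]//|[hP [i hi [-> _]]]].
  have hB := spanA P h PK hA; have hi' : coord P.1 h 0 i != 0 by rewrite gt_eqF.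
  have re := replace_row_eqmx fP hB hi'.
  split; first exact: replace_row_free.
    by apply/andP; case/andP: re => r1 r2; case/andP: PA => p1 p2; split;
      [exact: submx_trans r1 p1|exact: submx_trans p2 r2].
  apply: row_cone_comb => k; rewrite row_replace; case: ifP => // _.
  exact: rowA.
- move=> x xA; have [P PK xP] := K2 x xA; have [fP PA PC] := K1 P PK.
  have [hP|hP] := pselect (row_cone P.1 h).
    have [i hi xi] := subdiv_cover fP hP hn xP.
    exists (replace_row P.1 h i, P.2 - (e / coord P.1 h 0 i) *: col i (pinvmx P.1)) => //.
    apply/flatten_mapP; exists P => //; rewrite /subdiv asboolT//.
    by apply/mapP; exists i => //; rewrite mem_filter hi mem_enum.
  exists P => //; apply/flatten_mapP; exists P => //.
  by rewrite /subdiv asboolF// inE.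
- move=> Q Q' k /flatten_mapP[P PK QP] /flatten_mapP[P' PK' QP'].
  have [fP PA PC] := K1 P PK; have [fP' PA' PC'] := K1 P' PK'.
  have old : lin Q.2 (row k P'.1) <= lin P'.2 (row k P'.1) /\
     (lin Q.2 (row k P'.1) = lin P'.2 (row k P'.1) -> row_cone Q.1 (row k P'.1)).
    have [le_g eq_g] := K3 P P' k PK PK'.
    have gP := spanA P _ PK (rowA P' k PK').
    case/subdivP: QP => [[_ ->]//|[hP [i hi [-> linQ]]]]; rewrite linQ.
    have [lt_g|] := ltP (lin P.2 (row k P'.1)) (lin P'.2 (row k P'.1)).
      have lt := E1 P P' i k PK PK' lt_g.
      by split=> [|eq]; [exact: ltW|move: lt; rewrite eq ltxx].
    move=> ge_g; have eqg : lin P.2 (row k P'.1) = lin P'.2 (row k P'.1).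
      by apply/eqP; rewrite eq_le le_g.
    have gc := eq_g eqg; have [_ g0] := (row_coneP _ fP).1 gc.
    rewrite eqg; split.
      by rewrite gerBl mulr_ge0// ltW// divr_gt0.
    move=> /eqP; rewrite eq_sym -subr_eq0 opprB addrC subrK mulf_eq0.
    rewrite gt_eqF ?divr_gt0//= => /eqP gi0.
    apply/(row_cone_replace fP hP hi gP); rewrite gi0; split=> // j _.
    by rewrite mul0r mulr0.
  case/subdivP: QP' => [[_ ->]//|[hP' [i' hi' [-> linQ']]]].
  rewrite row_replace; case: eqP => [_|/eqP ki]; last first.
    rewrite linQ' coord_row// [delta_mx _ _ _ _]mxE eqxx /= eq_sym (negbTE ki) mulr0 subr0.
    exact: old.
  have hi'0 : coord P'.1 h 0 i' != 0 by rewrite gt_eqF.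
  rewrite linQ' divfK//.
  have [le_h eq_h] := complex_le rK PK PK' hP'.
  case/subdivP: QP => [[nhP ->]|[hP [i hi [-> linQ]]]].
    have lt_h : lin P.2 h < lin P'.2 h.
      by rewrite lt_neqAle le_h andbT; apply/negP => /eqP /eq_h.
    have lt := E2 P P' PK PK' lt_h.
    by split=> [|eq]; [exact: ltW|move: lt; rewrite eq ltxx].
  have hi0 : coord P.1 h 0 i != 0 by rewrite gt_eqF.
  rewrite linQ divfK// (eq_h.2 hP); split=> // _.
  have := row_cone_row (replace_row P.1 h i) i.
  by rewrite row_replace eqxx.
Qed.

Fixpoint stellar_chain (hs : seq 'rV[R]_n) B B' : Prop :=
  if hs is h :: hs' then exists2 B1, stellar h B B1 & stellar_chain hs' B1 B'
  else B' = B.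

Lemma stellar_chain_cat hs1 hs2 B B' : stellar_chain (hs1 ++ hs2) B B' ->
  exists2 B1, stellar_chain hs1 B B1 & stellar_chain hs2 B1 B'.
Proof.
elim: hs1 B => [|h hs1 IH] B /=; first by exists B.
by move=> [B1 s1 /IH[B2 c1 c2]]; exists B2 => //; exists B1.
Qed.

Lemma stellar_chain_complex hs : row_free A ->
  (forall h, h \in hs -> row_cone A h /\ h != 0) ->
  exists2 K, regular_complex K &
    forall P, P \in K -> stellar_chain hs A P.1.
Proof.
move=> fA hA.
suff : forall K, regular_complex K -> exists2 K', regular_complex K' &
    forall P', P' \in K' -> exists2 P, P \in K & stellar_chain hs P.1 P'.1.
  move=> /(_ _ (regular_complex1 fA))[K' rK' hK']; exists K' => // P' /hK'[P].
  by rewrite inE => /eqP->.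
elim: hs hA => [|h hs IH] hA K rK; first by exists K => // P PK; exists P.
have [hAh hn] := hA h (mem_head _ _).
have [K1 rK1 h1] := stellar_complex rK hAh hn.
have [K2 rK2 h2] := IH (fun g gs => hA g (@mem_behead _ (h :: hs) g gs)) K1 rK1.
exists K2 => // P2 /h2[P1 /h1[P PK s1] c1]; exists P => //=.
by exists P1.1.
Qed.

End Complex.

Section Pairing.
Variable T : finType.

Definition members (ps : seq (T * T)) := flatten [seq [:: p.1; p.2] | p <- ps].

Lemma pairing (X : {set T}) (e : rel T) :
  (forall x, x \in X -> e x x) ->
  (forall x y, x \in X -> y \in X -> e x y -> e y x) ->
  (forall x y z, x \in X -> y \in X -> z \in X -> e x y -> e y z -> e x z) ->
  (forall x, x \in X -> ~~ odd #|[set y in X | e x y]|) ->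
  exists ps : seq (T * T), [/\ uniq (members ps),
    forall x, (x \in members ps) = (x \in X) &
    forall p, p \in ps -> e p.1 p.2].
Proof.
have [k] := ubnP #|X|; elim: k X => // k IH X Xk er es et ev.
have [X0|/set0Pn[a aX]] := eqVneq X set0.
  by exists [::]; split=> // x; rewrite X0 inE.
have acl : a \in [set y in X | e a y] by rewrite inE aX er.
have [b bcl ba] : exists2 b, b \in [set y in X | e a y] & b != a.
  have /card_gt1P[x [y [xX yX xy]]] : (1 < #|[set y in X | e a y]|)%N.
    by have := ev a aX; rewrite (cardsD1 a) acl; case: #|_| => //.
  have [xa|xa] := eqVneq x a; last by exists x.
  by exists y => //; rewrite -xa eq_sym.
have [bX eab] : b \in X /\ e a b by move: bcl; rewrite inE => /andP.
have sub x : x \in X :\ a :\ b -> [/\ x \in X, x != a & x != b].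
  by rewrite !inE => /and3P[].
have [|||||ps [ups mps eps]] := IH (X :\ a :\ b).
- have := cardsD1 a X; have := cardsD1 b (X :\ a); rewrite aX !inE bX ba.
  by move: Xk; clear; lia.
- by move=> x /sub[xX _ _]; exact: er.
- by move=> x y /sub[xX _ _] /sub[yX _ _]; exact: es.
- by move=> x y z /sub[xX _ _] /sub[yX _ _] /sub[zX _ _]; exact: et.
- move=> x /sub[xX xa xb].
  have := ev x xX; rewrite (cardsD1 a) (cardsD1 b).
  have -> : [set y in X | e x y] :\ a :\ b = [set y in X :\ a :\ b | e x y].
    by apply/setP => y; rewrite !inE; case: (y == b); case: (y == a).
  have -> : (b \in [set y in X | e x y] :\ a) = (a \in [set y in X | e x y]).
    rewrite !inE ba aX bX /=; apply/idP/idP => h; last exact: et eab.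
    by apply: et h _ => //; exact: es.
  by rewrite addnA oddD oddD addbb.
exists ((a, b) :: ps); split.
- rewrite /members /= -/(members ps) ups andbT inE !mps !inE.
  by rewrite !eqxx /= !andbF orbF eq_sym ba.
- move=> x; rewrite /members /= -/(members ps) !inE mps !inE.
  by case: eqP => [->|_] /=; [rewrite aX|case: eqP => [->|_] //=; rewrite ?bX].
- by move=> p; rewrite inE => /orP[/eqP->//|/eps].
Qed.

End Pairing.

(** * Irreducible lattice points *)

Section Arithmetic.
Variables (R : realType) (r n : nat) (A : 'M[R]_(r, n)).
Hypothesis teA : tee A.
Hypothesis trA : tern_mx A.
Hypothesis fA : row_free A.
Implicit Types (B : 'M[R]_(r, n)) (x y z h : 'rV[R]_n).

Definition lattice x := (x <= A)%MS /\ integer_vector x.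
Definition lattice_cone x := row_cone A x /\ integer_vector x.

Definition irreducible h := [/\ lattice_cone h, h != 0 &
  forall y z, lattice_cone y -> lattice_cone z -> h = y + z -> y = 0 \/ z = 0].

Lemma lattice_coneW x : lattice_cone x -> lattice x.
Proof. by move=> [[c c0 ->] ix]; split=> //; exact: submxMl. Qed.

Lemma lat_coord x : lattice x -> lat A (coord A x).
Proof. by move=> [xA ix] j; rewrite coordK//; exact: ix. Qed.

Lemma quarter_coord x i : lattice x -> 4 * coord A x 0 i \is a Num.int.
Proof. by move=> /lat_coord lx; exact: (te_structure teA trA fA).1. Qed.

Lemma matching : exists ps : seq ('I_r * 'I_r), [/\ uniq (members ps),
  forall p, p \in ps -> p.1 != p.2 /\ par A p.1 p.2,
  forall p x, p \in ps -> lattice x ->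
    2 * (coord A x 0 p.1 - coord A x 0 p.2) \is a Num.int &
  forall i x, i \notin members ps -> lattice x ->
    2 * coord A x 0 i \is a Num.int].
Proof.
pose X := [set i | `[< exists2 c, lat A c & 2 * c 0 i \isn't a Num.int >]].
have [_ S2] := te_structure teA trA fA.
have XP i : reflect (exists2 c, lat A c & 2 * c 0 i \isn't a Num.int) (i \in X).
  by rewrite inE; exact: asboolP.
have cl i j : i \in X -> j \in qclass A i -> j \in X.
  move=> /XP[c lc ci] /qclassP[_ /(_ c lc) h]; apply/XP; exists c => //.
  apply: contra ci => cj; rewrite -[2 * c 0 i](subrK (2 * c 0 j)) -mulrBr.
  exact: rpredD.
have [||||ps [ups mps eps]] := @pairing _ X (fun i j => j \in qclass A i).
- by move=> i _; apply/qclassP; split=> // c _; rewrite subrr mulr0 rpred0.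
- move=> i j _ _ /qclassP[pij h]; apply/qclassP; split; first exact: par_sym.
  by move=> c lc; rewrite -opprB mulrN rpredN h.
- move=> i j k _ _ _ /qclassP[pij h] /qclassP[pjk h']; apply/qclassP; split.
    exact: par_trans pjk.
  by move=> c lc; rewrite -[c 0 i](subrK (c 0 j)) -addrA mulrDr rpredD ?h ?h'.
- move=> i iX; have /XP[c lc ci] := iX.
  have [ev _] := S2 c lc i ci; congr (~~ odd _): ev.
  by apply: eq_card => j; rewrite [RHS]inE; case: (boolP (_ \in qclass _ _));
    rewrite ?andbF// => /(cl _ _ iX)->.
exists ps; split=> //.
- move=> p pps; case/qclassP: (eps p pps) => pp _; split=> //.
  apply/negP => /eqP e; move: ups.
  have /splitPr[s1 s2] : p \in ps by [].
  rewrite /members map_cat flatten_cat cat_uniq /= => /and3P[_ _].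
  by rewrite inE e eqxx.
- move=> p x pps lx; case/qclassP: (eps p pps) => _; apply; exact: lat_coord.
- move=> i x; rewrite mps => /XP h lx; apply/negPn/negP => hn; apply: h.
  by exists (coord A x) => //; exact: lat_coord.
Qed.

Lemma lattice_coneD x y : lattice_cone x -> lattice_cone y -> lattice_cone (x + y).
Proof.
move=> [xA ix] [yA iy]; split; first exact: row_coneD.
by move=> j; rewrite mxE; apply: rpredD; [exact: ix|exact: iy].
Qed.

Lemma lattice_cone_ge0 x i : lattice_cone x -> 0 <= coord A x 0 i.
Proof. by move=> [/(row_coneP _ fA)[_ h] _]. Qed.

Lemma span_coord0 x : (x <= A)%MS -> coord A x = 0 -> x = 0.
Proof. by move=> xA e; rewrite -(coordK xA) e mul0mx. Qed.

Lemma irreducible_row i : irreducible (row i A).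
Proof.
have lc : lattice_cone (row i A).
  split; first exact: row_cone_row.
  by move=> j; rewrite mxE; exact/tern_int/trA.
have [q hq] := row_neq0 i fA.
split=> //.
  by apply/eqP => /rowP/(_ q)/eqP; rewrite !mxE (negbTE hq).
move=> y z ly lz e.
have [yA zA] := (lattice_coneW ly, lattice_coneW lz).
have ce j : coord A y 0 j + coord A z 0 j = (j == i)%:R.
  have := congr1 (fun x => coord A x 0 j) e; rewrite coordD coord_row//.
  by rewrite ![in RHS]mxE => <-; rewrite mxE eqxx.
have off w : lattice_cone w -> (forall j, coord A w 0 j <= (j == i)%:R) ->
    coord A w = coord A w 0 i *: delta_mx 0 i.
  move=> lw h; apply/rowP => j; rewrite [RHS]mxE [delta_mx _ _ _ _]mxE eqxx /=.
  have [->|ji] := eqVneq j i; first by rewrite mulr1.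
  rewrite mulr0; apply/eqP; rewrite eq_le lattice_cone_ge0// andbT.
  by have := h j; rewrite (negbTE ji).
have ley j : coord A y 0 j <= (j == i)%:R.
  by rewrite -ce lerDl lattice_cone_ge0.
have yi : coord A y 0 i \is a Num.int.
  have yq : y 0 q = coord A y 0 i * A i q.
    by rewrite -{1}(coordK yA.1) {1}(off y ly ley) -scalemxAl -rowE !mxE.
  have := ly.2 q; rewrite yq.
  by case: (tern_neq0 (trA i q) hq) => ->; rewrite ?mulr1 ?mulrN1 ?rpredN.
have [y1|y1] := ltP (coord A y 0 i) 1.
  left; apply: span_coord0 yA.1 _; rewrite (off y ly ley).
  by rewrite (int_lt1 yi) ?scale0r// lattice_cone_ge0.
right; apply: span_coord0 zA.1 _; rewrite (off z lz) => [|j].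
  have := ce i; rewrite eqxx mulr1n => h; rewrite (_ : coord A z 0 i = 0) ?scale0r//.
  by have := lattice_cone_ge0 i lz; lra.
by rewrite -ce lerDr lattice_cone_ge0.
Qed.

Definition midpoint (p : 'I_r * 'I_r) : 'rV[R]_n := 2^-1 *: (row p.1 A + row p.2 A).

Lemma coord_midpoint p j :
  coord A (midpoint p) 0 j = 2^-1 * ((j == p.1)%:R + (j == p.2)%:R).
Proof.
by rewrite coordZ coordD !coord_row// !mxE eqxx /=.
Qed.

Lemma midpoint_cone p : row_cone A (midpoint p).
Proof.
by apply: row_coneZ; rewrite ?invr_ge0//; apply: row_coneD; exact: row_cone_row.
Qed.

Lemma irreducible_midpoint p : p.1 != p.2 -> par A p.1 p.2 ->
  irreducible (midpoint p).
Proof.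
move=> p12 pp.
have lc : lattice_cone (midpoint p).
  split; first exact: midpoint_cone.
  move=> j; rewrite !mxE; have := pp j.
  by case/or3P: (trA p.1 j) => /eqP->; case/or3P: (trA p.2 j) => /eqP->;
    rewrite ?eqxx ?oppr_eq0 ?oner_eq0// => _;
    [rewrite (_ : _ * _ = 0)|rewrite (_ : _ * _ = 1)|rewrite (_ : _ * _ = 0)
    |rewrite (_ : _ * _ = 0)|rewrite (_ : _ * _ = -1)];
    rewrite ?rpredN ?rpred0 ?rpred1//; lra.
have cm : coord A (midpoint p) 0 p.1 = 2^-1.
  by rewrite coord_midpoint eqxx (negbTE p12) addr0 mulr1.
split=> //.
  apply/eqP => e; move: cm; rewrite e -(subrr 0) coordB subrr mxE => /eqP.
  by rewrite eq_sym invr_eq0 pnatr_eq0.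
move=> y z ly lz e.
have [yA zA] := (lattice_coneW ly, lattice_coneW lz).
have ce j : coord A y 0 j + coord A z 0 j = coord A (midpoint p) 0 j.
  by have := congr1 (fun x => coord A x 0 j) e; rewrite coordD [in RHS]mxE.
have sy j : j != p.1 -> j != p.2 -> coord A y 0 j = 0.
  move=> j1 j2; have := ce j; rewrite coord_midpoint (negbTE j1) (negbTE j2).
  rewrite addr0 mulr0 => h; have := lattice_cone_ge0 j ly.
  by have := lattice_cone_ge0 j lz; lra.
have [q hq] : exists q, A p.1 q <> - A p.2 q.
  apply: contrapT => h; apply: (@row_free_neq R _ _ A p.1 p.2 (-1) fA) => // q.
  by rewrite mulN1r; apply: contrapT => h'; apply: h; exists q.
have [pm1 e1] : (A p.1 q = 1 \/ A p.1 q = -1) /\ - A p.2 q = - A p.1 q.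
  apply: tern_opp hq; first exact: trA.
    by rewrite tern_norm normrN -tern_norm; exact: trA.
  by rewrite oppr_eq0; exact: pp.
have s12 : coord A y 0 p.1 + coord A y 0 p.2 \is a Num.int.
  have := ly.2 q; rewrite -{1}(coordK yA.1) mxE (bigD1 p.1)//= (bigD1 p.2) 1?eq_sym//=.
  rewrite [X in _ + (_ + X)]big1 ?addr0 => [|j /andP[j1 j2]]; last first.
    by rewrite sy ?mul0r.
  rewrite (oppr_inj e1) -mulrDl.
  by case: pm1 => ->; rewrite ?mulr1 ?mulrN1 ?rpredN.
have c1 := ce p.1; have c2 := ce p.2; move: c1 c2; rewrite !coord_midpoint.
rewrite !eqxx (negbTE p12) eq_sym (negbTE p12) addr0 add0r mulr1 => c1 c2.
have [y1 y2 z1 z2] := And4 (lattice_cone_ge0 p.1 ly) (lattice_cone_ge0 p.2 ly)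
  (lattice_cone_ge0 p.1 lz) (lattice_cone_ge0 p.2 lz).
have [lt1|ge1] := ltP (coord A y 0 p.1 + coord A y 0 p.2) 1.
  left; apply: span_coord0 yA.1 _; apply/rowP => j; rewrite [RHS]mxE.
  have s0 := int_lt1 s12 (addr_ge0 y1 y2) lt1.
  have [->|j1] := eqVneq j p.1; first by lra.
  by have [->|j2] := eqVneq j p.2; [lra|exact: sy].
right; apply: span_coord0 zA.1 _; apply/rowP => j; rewrite [RHS]mxE.
have [->|j1] := eqVneq j p.1; first by lra.
have [->|j2] := eqVneq j p.2; first by lra.
have := ce j; rewrite sy// add0r coord_midpoint (negbTE j1) (negbTE j2).
by rewrite addr0 mulr0.
Qed.

Lemma irreducible_ge1 B h j : row_free B -> (B == A)%MS ->
  (forall k, irreducible (row k B)) -> irreducible h -> row_cone B h ->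
  1 <= coord B h 0 j -> h = row j B.
Proof.
move=> fB /andP[BA AB] iB ih hB hj; have [_ _ irr] := ih.
have [hBs h0] := (row_coneP _ fB).1 hB.
have [lj nj _] := iB j.
have lz : lattice_cone (h - row j B).
  split.
    apply: (@row_cone_comb R n r A r B) => [k|]; first by have [[]] := iB k.
    apply/(row_coneP _ fB); split; first by rewrite addmx_sub// eqmx_opp row_sub.
    move=> k; rewrite coordB coord_row// !mxE /=.
    by have [->|kj] := eqVneq k j; rewrite ?subr_ge0 ?subr0.
  by move=> k; rewrite !mxE; apply: rpredB; [case: ih => -[_]|case: lj => _ /(_ k); rewrite mxE].
have [] := irr (row j B) (h - row j B) lj lz; first by rewrite addrC subrK.
  by move=> e; rewrite e eqxx in nj.
by move/eqP; rewrite subr_eq0 => /eqP.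
Qed.

Lemma irreducible_list : exists hs : seq 'rV[R]_n,
  forall h, h \in hs <-> irreducible h.
Proof.
exists [seq h <- [seq (\row_i ((f i : nat)%:R / 4)) *m A
   | f : {ffun 'I_r -> 'I_5}] | `[< irreducible h >]] => h.
rewrite mem_filter; split=> [/andP[/asboolP]//|ih].
rewrite asboolT//=.
have [lh _ _] := ih; have [hA ih'] := lattice_coneW lh.
have le1 j : coord A h 0 j <= 1.
  rewrite leNgt; apply/negP => gt1.
  have AA : (A == A)%MS by rewrite submx_refl.
  have e := irreducible_ge1 fA AA irreducible_row ih lh.1 (ltW gt1).
  move: gt1; rewrite e.
  by rewrite coord_row// !mxE !eqxx ltxx.
have nat4 j : exists m : 'I_5, 4 * coord A h 0 j = (m : nat)%:R.
  have /intrP[m em] := quarter_coord j (lattice_coneW lh).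
  have m0 : 0 <= m by rewrite -(ler0z R) -em mulr_ge0 ?lattice_cone_ge0.
  have m4 : m <= 4 by rewrite -(ler_int R) -em; have := le1 j; lra.
  case: m em m0 m4 => // m em _ m4.
  have m5 : (m < 5)%N by rewrite ltnS -lez_nat.
  by exists (Ordinal m5).
have [f hf] := choice nat4.
apply/imageP; exists (finfun f) => //; rewrite -[LHS](coordK hA); congr (_ *m _).
apply/rowP => j; rewrite [RHS]mxE ffunE -hf mulrC mulKf ?pnatr_eq0//.
Qed.

End Arithmetic.

(** * Unimodularity of the final subdivision *)

Section Chain.
Variables (R : realType) (r n : nat) (A : 'M[R]_(r, n)).
Hypothesis teA : tee A.
Hypothesis trA : tern_mx A.
Hypothesis fA : row_free A.
Implicit Types (B : 'M[R]_(r, n)) (x y z h : 'rV[R]_n).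

Definition good B :=
  [/\ row_free B, (B == A)%MS & forall k, irreducible A (row k B)].

Lemma good_span B x : good B -> (x <= A)%MS -> (x <= B)%MS.
Proof. by move=> [_ /andP[_ AB] _] xA; exact: submx_trans AB. Qed.

Lemma good_sub B x : good B -> row_cone B x -> row_cone A x.
Proof.
move=> [_ _ iB]; apply: row_cone_comb => k; by have [[]] := iB k.
Qed.

Lemma good_stellar h B B' : irreducible A h -> good B -> stellar h B B' -> good B'.
Proof.
move=> ih gB [[_ ->//]|[hB [i hi ->]]]; have [fB /andP[BA AB] iB] := gB.
have hs : (h <= B)%MS by have [[c _ ->]] := hB; exact: submxMl.
have hi' : coord B h 0 i != 0 by rewrite gt_eqF.
have /andP[r1 r2] := replace_row_eqmx fB hs hi'.
split; first exact: replace_row_free.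
  by apply/andP; split; [exact: submx_trans BA|exact: submx_trans AB r2].
by move=> k; rewrite row_replace; case: ifP => // _; exact: iB.
Qed.

Lemma good_start : good A.
Proof. by split=> //; rewrite ?submx_refl// => k; exact: irreducible_row. Qed.

Lemma membersP (T : eqType) (ps : seq (T * T)) i :
  reflect (exists2 p, p \in ps & i = p.1 \/ i = p.2)
    (i \in flatten [seq [:: p.1; p.2] | p <- ps]).
Proof.
apply: (iffP flatten_mapP) => -[p pps]; last first.
  by move=> h; exists p => //; rewrite !inE; case: h => ->; rewrite eqxx ?orbT.
by rewrite !inE => /orP[]/eqP->; exists p; auto.
Qed.

(* The midpoint of each pair has replaced one of its two rows. *)
Definition paired B (ps : seq ('I_r * 'I_r)) :=
  (forall i, i \notin members ps ->
     forall x, (x <= A)%MS -> coord B x 0 i = coord A x 0 i) /\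
  (forall p, p \in ps ->
     (forall x, (x <= A)%MS -> coord B x 0 p.1 = 2 * coord A x 0 p.1 /\
        coord B x 0 p.2 = coord A x 0 p.2 - coord A x 0 p.1) \/
     (forall x, (x <= A)%MS -> coord B x 0 p.1 = coord A x 0 p.1 - coord A x 0 p.2 /\
        coord B x 0 p.2 = 2 * coord A x 0 p.2)).

Lemma paired_step B B' p ps : good B -> paired B ps -> p.1 != p.2 ->
  p.1 \notin members ps -> p.2 \notin members ps ->
  stellar (midpoint A p) B B' -> paired B' (p :: ps).
Proof.
move=> gB [out inn] p12 n1 n2 st; have [fB _ _] := gB.
have hA : (midpoint A p <= A)%MS.
  by have [c _ ->] := midpoint_cone A p; exact: submxMl.
set h := midpoint A p in st hA.
have hB := good_span gB hA.
have off q : q \in ps -> [/\ q.1 != p.1, q.1 != p.2, q.2 != p.1 & q.2 != p.2].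
  by move=> qps; split; apply/eqP => e; [move: n1|move: n2|move: n1|move: n2];
    rewrite -e => /membersP; apply; exists q; auto.
have ch i : coord B h 0 i = 2^-1 * ((i == p.1)%:R + (i == p.2)%:R).
  rewrite -(coord_midpoint fA p).
  have [/membersP[q qps iq]|/out->//] := boolP (i \in members ps).
  have [q1 q2 q3 q4] := off q qps.
  have z j : j != p.1 -> j != p.2 -> coord A h 0 j = 0.
    by move=> j1 j2; rewrite coord_midpoint// (negbTE j1) (negbTE j2) addr0 mulr0.
  have [z1 z2] : coord A h 0 q.1 = 0 /\ coord A h 0 q.2 = 0 by rewrite !z.
  by case: iq => ->; case: (inn q qps) => /(_ h hA); rewrite z1 z2 ?mulr0 ?subr0 => -[].
have e1 : coord B h 0 p.1 = 2^-1 by rewrite ch eqxx (negbTE p12) addr0 mulr1.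
have e2 : coord B h 0 p.2 = 2^-1 by rewrite ch eqxx eq_sym (negbTE p12) add0r mulr1.
have hc : row_cone B h.
  by apply/(row_coneP _ fB); split=> // i; rewrite ch mulr_ge0 ?invr_ge0 ?addr_ge0.
case: st => [[//]|[_ [i hi ->]]].
have hi' : coord B h 0 i != 0 by rewrite gt_eqF.
have ii : i = p.1 \/ i = p.2.
  move: hi; rewrite ch; case: eqP => [->|_]; first by left.
  by case: eqP => [->|_]; [right|rewrite addr0 mulr0 ltxx].
have ci : coord B h 0 i = 2^-1 by case: ii => ->.
have upd x j : (x <= A)%MS -> coord (replace_row B h i) x 0 j =
    if j == i then 2 * coord B x 0 i
    else coord B x 0 j - ((j == p.1)%:R + (j == p.2)%:R) * coord B x 0 i.
  move=> xA; rewrite coord_replace ?(good_span gB)// mxE ci invrK; case: eqP => _.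
    by rewrite mulrC.
  by rewrite ch; congr (_ - _); field.
split=> [j|q].
  rewrite /members /= !inE !negb_or -/(members ps) => /and3P[j1 j2 jps] x xA.
  have ji : (j == i) = false by case: ii => ->; apply/negbTE.
  by rewrite upd// ji (negbTE j1) (negbTE j2) addr0 mul0r subr0 out.
rewrite inE => /orP[/eqP->|qps].
  have p21 : (p.2 == p.1) = false by rewrite eq_sym (negbTE p12).
  by case: ii => ii; [left|right] => x xA; rewrite !upd// ii ?eqxx ?p21
    ?(negbTE p12) ?add0r ?addr0 ?mul1r !out.
have [q1 q2 q3 q4] := off q qps.
have ni j : j != p.1 -> j != p.2 -> (j == i) = false.
  by move=> j1 j2; case: ii => ->; apply/negbTE.
by case: (inn q qps) => H; [left|right] => x xA; rewrite !upd// !ni//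
  (negbTE q1) (negbTE q2) (negbTE q3) (negbTE q4) addr0 !mul0r !subr0; exact: H.
Qed.

Lemma paired_chain ps done B B' : good B -> paired B done ->
  uniq (members ps) -> (forall i, i \in members ps -> i \notin members done) ->
  (forall p, p \in ps -> p.1 != p.2 /\ par A p.1 p.2) ->
  stellar_chain [seq midpoint A p | p <- ps] B B' ->
  good B' /\ paired B' (catrev ps done).
Proof.
elim: ps done B => [|p ps IH] done B gB pB ups dis pp /=; first by move=> ->.
move=> [B1 s1 c1]; have [p12 par12] := pp p (mem_head _ _).
have ip : irreducible A (midpoint A p) by exact: irreducible_midpoint.
have := ups; rewrite /members /= !inE -/(members ps) => /and3P[h1 h2 h3].
have n1 : p.1 \notin members done.
  by apply: dis; rewrite /members /= inE eqxx.
have n2 : p.2 \notin members done.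
  by apply: dis; rewrite /members /= !inE eqxx orbT.
apply: (IH (p :: done) B1) => //.
- exact: good_stellar s1.
- exact: paired_step s1.
- move=> i ips; rewrite /members /= -/(members done) !inE !negb_or dis; last first.
    by rewrite /members /= -/(members ps) !inE ips !orbT.
  rewrite andbT; apply/andP; split; apply/eqP => e; move: h1 h2; rewrite -e ips //.
  by rewrite orbT.
- by move=> q qps; apply: pp; rewrite inE qps orbT.
Qed.

Variable ps : seq ('I_r * 'I_r).
Hypothesis ps_half : forall p x, p \in ps -> lattice A x ->
    2 * (coord A x 0 p.1 - coord A x 0 p.2) \is a Num.int.
Hypothesis out_half : forall i x, i \notin members ps -> lattice A x ->
    2 * coord A x 0 i \is a Num.int.
Variable B1 : 'M[R]_(r, n).
Hypothesis gB1 : good B1.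
Hypothesis pB1 : paired B1 (rev ps).

Let members_rev i : (i \in members (rev ps)) = (i \in members ps).
Proof. by apply/membersP/membersP => -[p]; rewrite ?mem_rev; exists p; rewrite ?mem_rev. Qed.

Lemma paired_half x i : lattice A x -> 2 * coord B1 x 0 i \is a Num.int.
Proof.
move=> lx; have [out inn] := pB1; have xA := lx.1.
have [/membersP[p pps ip]|nips] := boolP (i \in members (rev ps)); last first.
  by rewrite out// out_half// -members_rev.
have pps' : p \in ps by rewrite mem_rev in pps.
have i4 j : 2 * (2 * coord A x 0 j) \is a Num.int.
  by rewrite mulrA -natrM; exact: quarter_coord.
have d12 := ps_half pps' lx.
have d21 : 2 * (coord A x 0 p.2 - coord A x 0 p.1) \is a Num.int.
  by rewrite -opprB mulrN rpredN.
by case: ip => ->; case: (inn p pps) => /(_ x xA)[e1 e2]; rewrite ?e1 ?e2.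
Qed.

(* A lattice point of the whole cone lying below a point with coordinates 0 and
   1/2 in a subdivided cone stays in that subdivided cone. *)
Lemma paired_below h z : (h <= A)%MS ->
  (forall i, coord B1 h 0 i = 0 \/ coord B1 h 0 i = 2^-1) ->
  lattice_cone A z -> lattice_cone A (h - z) -> row_cone B1 z.
Proof.
move=> hA hh lz lhz; have [out inn] := pB1; have [fB _ _] := gB1.
have [zA iz] := lattice_coneW lz.
apply/(row_coneP _ fB); split; first exact: good_span.
have z0 i : 0 <= coord A z 0 i by exact: lattice_cone_ge0.
have zh i : coord A z 0 i <= coord A h 0 i.
  by have := lattice_cone_ge0 fA i lhz; rewrite coordB !mxE subr_ge0.
move=> i; have [/membersP[p pps ip]|nips] := boolP (i \in members (rev ps)); last first.
  by rewrite out.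
have pps' : p \in ps by rewrite mem_rev in pps.
have key a b : 2 * coord A h 0 a = 0 \/ 2 * coord A h 0 a = 2^-1 ->
    2 * (coord A z 0 a - coord A z 0 b) \is a Num.int ->
    coord A z 0 a <= coord A z 0 b.
  move=> ha iab; rewrite leNgt; apply/negP => lt.
  have za := z0 a; have zha := zh a; have zb := z0 b.
  have : 1 <= 2 * (coord A z 0 a - coord A z 0 b).
    by apply: (int_ge1 iab); rewrite pmulr_rgt0// subr_gt0.
  by case: ha => ha; lra.
have d12 := ps_half pps' (lattice_coneW lz).
have d21 : 2 * (coord A z 0 p.2 - coord A z 0 p.1) \is a Num.int.
  by rewrite -opprB mulrN rpredN.
case: (inn p pps) => H; have [e1 e2] := H h hA; have [f1 f2] := H z zA.
  have := hh p.1; rewrite e1 => h1.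
  by case: ip => ->; rewrite ?f1 ?f2 ?mulr_ge0// subr_ge0 key.
have := hh p.2; rewrite e2 => h2.
by case: ip => ->; rewrite ?f1 ?f2 ?mulr_ge0// subr_ge0 key.
Qed.

Definition stage2 B (done : seq 'rV[R]_n) :=
  [/\ good B,
      forall x i, lattice A x -> 2 * coord B x 0 i \is a Num.int,
      forall i, row i B = row i B1 \/
        forall x, lattice A x -> coord B x 0 i \is a Num.int &
      forall h, h \in done -> irreducible A h /\
        (row_cone B h -> exists i, row i B = h)].

Lemma stage2_step B B' done h : irreducible A h -> stage2 B done ->
  stellar h B B' -> stage2 B' (h :: done).
Proof.
move=> ih [gB half old dn] st; have gB' := good_stellar ih gB st.
have [fB BA iB] := gB.
case: st gB' => [[nh ->] _|[hB [i hi ->]] gB'].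
  split=> // g; rewrite inE => /orP[/eqP->|]; last exact: dn.
  by split=> // /nh.
have lh : lattice A h by have [lh _ _] := ih; exact: lattice_coneW lh.
have [hs h0] := (row_coneP _ fB).1 hB.
have [[j hj]|nj] := pselect (exists j, 1 <= coord B h 0 j).
  have eh : h = row j B by exact: irreducible_ge1 fB BA iB ih hB hj.
  have ij : i = j.
    move: hi; rewrite eh coord_row// mxE eqxx /=.
    by case: eqP => // _; rewrite ltxx.
  have eB : replace_row B h i = B.
    by apply/row_matrixP => k; rewrite row_replace; case: eqP => // ->; rewrite ij.
  rewrite eB; split=> // g; rewrite inE => /orP[/eqP->|]; last exact: dn.
  by split=> // _; exists j.
have a01 j : coord B h 0 j = 0 \/ coord B h 0 j = 2^-1.
  apply: half_lt1 => //; first exact: half.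
  by rewrite ltNge; apply/negP => hj; apply: nj; exists j.
have ai : coord B h 0 i = 2^-1 by case: (a01 i) hi => ->; rewrite ?ltxx.
have ai0 : coord B h 0 i != 0 by rewrite gt_eqF.
have upd x j : (x <= A)%MS -> coord (replace_row B h i) x 0 j =
    if j == i then 2 * coord B x 0 i
    else coord B x 0 j - coord B h 0 j * (2 * coord B x 0 i).
  move=> xA; rewrite (coord_replace fB hs ai0 (good_span gB xA)) mxE ai invrK.
  by rewrite (mulrC _ 2).
split=> //.
- move=> x j lx; rewrite (upd _ _ lx.1); case: eqP => _.
    by rewrite rpredM ?natr_int// half.
  rewrite mulrBr [2 * (coord B h 0 j * _)]mulrA; apply: rpredB; first exact: half.
  by apply: rpredM; exact: half.
- move=> j; have [->|ji] := eqVneq j i.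
    by right=> x lx; rewrite (upd _ _ lx.1) eqxx half.
  case: (old j) => [ej|int_j]; [left|right].
    by rewrite row_replace (negbTE ji).
  move=> x lx; rewrite (upd _ _ lx.1) (negbTE ji).
  have := int_j h lh; case: (a01 j) => ->; first by rewrite mul0r subr0 int_j.
  by rewrite (negbTE (half_notint R)).
move=> g; rewrite inE => /orP[/eqP->|gd].
  by split=> // _; exists i; rewrite row_replace eqxx.
have [ig gB0] := dn g gd; split=> // gB2.
have [|k ek] := gB0.
  apply: row_cone_comb gB2 => k; rewrite row_replace; case: ifP => // _.
  exact: row_cone_row.
have [ki|ki] := eqVneq k i; last by exists k; rewrite row_replace (negbTE ki).
have lg : lattice A g by have [lg _ _] := ig; exact: lattice_coneW lg.
have [fB' _ _] := gB'.
have [_ g0] := (row_coneP _ fB').1 gB2.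
have gc j : coord B g 0 j = (j == i)%:R.
  by rewrite -ek coord_row// mxE eqxx /= ki.
have hg : h = 2^-1 *: g.
  rewrite -(coordK hs) -(coordK (good_span gB lg.1)) scalemxAl; congr (_ *m _).
  apply/rowP => j; rewrite mxE gc; have [->|ji] := eqVneq j i.
    by rewrite ai mulr1.
  rewrite mulr0; have := g0 j; rewrite (upd _ _ lg.1) (negbTE ji) !gc eqxx.
  rewrite (negbTE ji) mulr1 sub0r oppr_ge0.
  by case: (a01 j) => -> //; rewrite mulVf ?pnatr_eq0// ler10.
have [lch hn _] := ih; have [_ _ irr] := ig.
have gh : g = h + h by rewrite hg -scalerDl (_ : 2^-1 + 2^-1 = 1) ?scale1r//; lra.
by case: (irr h h lch lch gh) => e; rewrite e eqxx in hn.
Qed.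

Lemma stage2_chain hs done B B' : (forall h, h \in hs -> irreducible A h) ->
  stage2 B done -> stellar_chain hs B B' -> stage2 B' (catrev hs done).
Proof.
elim: hs done B => [|h hs IH] done B ih sB /=; first by move=> ->.
move=> [B2 s2 c2]; apply: (IH (h :: done) B2) => //.
  by move=> g gs; apply: ih; rewrite inE gs orbT.
by apply: stage2_step s2 => //; exact: ih (mem_head _ _).
Qed.

Lemma stage2_unimodular B done : stage2 B done ->
  (forall h, irreducible A h -> h \in done) ->
  forall x, lattice A x -> forall i, coord B x 0 i \is a Num.int.
Proof.
move=> [gB half old dn] all_done.
have [fB BA iB] := gB; have [fB1 _ _] := gB1.
pose S x := finset (fun k => coord B x 0 k \isn't a Num.int).
have inS x k : (k \in S x) = (coord B x 0 k \isn't a Num.int) by rewrite inE.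
pose P (X : {set 'I_r}) := `[< exists2 x, lattice A x & S x = X >] && (0 < #|X|)%N.
suff key X : P X -> (forall Y, P Y -> #|X| <= #|Y|)%N -> False.
  move=> x lx i; apply/negPn/negP => ni.
  have PS : P (S x).
    apply/andP; split; first by apply/asboolP; exists x.
    by apply/card_gt0P; exists i; rewrite inS.
  case: (arg_minnP (fun X : {set 'I_r} => #|X|) PS) => X PX minX.
  exact: (key X PX minX).
move=> /andP[/asboolP[x lx eX] X0] minX.
pose hc : 'rV[R]_r := \row_k (if k \in X then 2^-1 else 0).
have hc01 k : hc 0 k = 0 \/ hc 0 k = 2^-1 by rewrite mxE; case: ifP; auto.
have oldX k : k \in X -> row k B = row k B1.
  by case: (old k) => // /(_ x lx) h; rewrite -eX inS h.
have sameB (c : 'rV[R]_r) : (forall k, k \notin X -> c 0 k = 0) -> c *m B = c *m B1.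
  move=> c0; rewrite !mulmx_sum_row; apply: eq_bigr => k _.
  by have [/oldX->|/c0->] := boolP (k \in X); rewrite ?scale0r.
pose h := hc *m B.
have hB1 : h = hc *m B1 by apply: sameB => k kX; rewrite mxE (negbTE kX).
have hcone : row_cone B h.
  by exists hc => // k; case: (hc01 k) => ->; rewrite ?invr_ge0.
have hA := good_sub gB hcone.
have ih' : integer_vector h.
  move=> j; have [xA ix] := lx.
  have -> : h 0 j = x 0 j - ((coord B x - hc) *m B) 0 j.
    by rewrite mulmxBl coordK ?(good_span gB)// -/h !mxE subKr.
  apply: rpredB; first exact: ix.
  rewrite mxE; apply: rpred_sum => k _; apply: rpredM.
    have -> : (coord B x - hc) 0 k = coord B x 0 k - if k \in X then 2^-1 else 0.
      by rewrite !mxE.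
    have [kX|kX] := boolP (k \in X); last first.
      by rewrite subr0; move: kX; rewrite -eX inS => /negPn.
    have [hk|//] := int_halfP (half x k lx).
    by move: kX; rewrite -eX inS hk.
  by have [[_ /(_ j)]] := iB k; rewrite mxE.
have hsp : (h <= A)%MS by have [c _ ->] := hA; exact: submxMl.
have [k0 k0X] : exists k, k \in X by apply/card_gt0P.
have ch : coord B h = hc by rewrite /h mul_coord.
have ch1 : coord B1 h = hc by rewrite hB1 mul_coord.
have hn : h != 0.
  apply/eqP => e; have := ch; rewrite e -(subrr 0) coordB subrr => /rowP/(_ k0)/eqP.
  by rewrite !mxE k0X eq_sym invr_eq0 pnatr_eq0.
have irr_h : irreducible A h.
  split=> // y z ly lz e.
  have ey : lattice_cone A (h - z) by rewrite e addrK.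
  have ez : lattice_cone A (h - y) by rewrite e addrAC subrr add0r.
  have h01 k : coord B1 h 0 k = 0 \/ coord B1 h 0 k = 2^-1 by rewrite ch1.
  have yc := paired_below hsp h01 ly ez; have zc := paired_below hsp h01 lz ey.
  have [ys y0] := (row_coneP _ fB1).1 yc; have [zs z0] := (row_coneP _ fB1).1 zc.
  have cyz k : coord B1 y 0 k + coord B1 z 0 k = hc 0 k.
    by rewrite -ch1 e coordD [RHS]mxE.
  have cy k : coord B1 y 0 k = 0 \/ coord B1 y 0 k = 2^-1.
    apply: half_lt1 => //; first by apply: paired_half; exact: lattice_coneW.
    by have := cyz k; have := z0 k; case: (hc01 k) => ->; lra.
  have cyX k : k \notin X -> coord B1 y 0 k = 0.
    move=> kX; have := cyz k; rewrite [RHS]mxE (negbTE kX).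
    by have := z0 k; have := y0 k; lra.
  have yE : y = coord B1 y *m B by rewrite sameB// coordK.
  have yB : coord B y = coord B1 y by rewrite {1}yE mul_coord.
  have Sy : {subset S y <= X}.
    by move=> k; rewrite inS yB; apply: contraR => /cyX->; rewrite rpred0.
  have [c0|c0] := posnP #|S y|.
    left; rewrite yE (_ : coord B1 y = 0) ?mul0mx//; apply/rowP => k; rewrite [RHS]mxE.
    have : k \notin S y by rewrite (card0_eq c0).
    rewrite inS yB => /negPn; case: (cy k) => -> //.
    by rewrite (negbTE (half_notint R)).
  have PS : P (S y).
    by rewrite /P c0 andbT; apply/asboolP; exists y => //; exact: lattice_coneW.
  have SX : S y = X by apply/eqP; rewrite eqEcard minX// andbT; apply/subsetP.
  right; have : y = h.
    rewrite yE /h; congr (_ *m _); apply/rowP => k; rewrite [RHS]mxE.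
    have [kX|/cyX//] := boolP (k \in X).
    move: kX; rewrite -SX inS yB; case: (cy k) => -> //; by rewrite rpred0.
  by move=> yh; move: e; rewrite yh -{1}[h]addr0 => /addrI.
have [_ /(_ hcone)[i ei]] := dn h (all_done h irr_h).
have : coord B h 0 i = 1 by rewrite -{1}ei coord_row// mxE !eqxx.
rewrite ch; case: (hc01 i) => -> /eqP; first by rewrite eq_sym oner_eq0.
by rewrite invr_eq1 (eqr_nat _ 2 1).
Qed.

Lemma stage2_start : stage2 B1 [::].
Proof. by split=> // [x i lx|i]; [exact: paired_half|left]. Qed.

End Chain.

Section Unimodular.
Variables (R : realType) (r n : nat) (A : 'M[R]_(r, n)).
Hypothesis teA : tee A.
Hypothesis trA : tern_mx A.
Hypothesis fA : row_free A.

Lemma unimodular_chain : exists hs : seq 'rV[R]_n,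
  (forall h, h \in hs -> irreducible A h) /\
  forall B, stellar_chain hs A B -> good A B /\
    forall x, lattice A x -> forall i, coord B x 0 i \is a Num.int.
Proof.
have [ps [ups ps_par ps_half out_half]] := matching teA trA fA.
have [irr irrP] := irreducible_list teA trA fA.
exists ([seq midpoint A p | p <- ps] ++ irr); split.
  move=> h; rewrite mem_cat => /orP[/mapP[p pps ->]|/irrP//].
  by have [p12 pp] := ps_par p pps; exact: irreducible_midpoint.
move=> B /stellar_chain_cat[B1 c1 c2].
have [] := paired_chain trA fA (good_start trA fA) (done := [::]) _ ups _ ps_par c1.
- by split.
- by [].
move=> gB1 pB1.
have s1 := stage2_start teA trA fA ps_half out_half gB1 pB1.
have s2 := stage2_chain (fun h hi => (irrP h).1 hi) s1 c2.
split; first by case: s2.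
apply: (stage2_unimodular teA trA fA ps_half out_half gB1 pB1 s2) => h /irrP.
by rewrite mem_rev.
Qed.

End Unimodular.

(** * Reduction to generators with entries 0, 1, -1 *)

Section Equimodular.
Variable R : realType.

Lemma sorting_perm k n (f : 'I_k -> 'I_n) : injective f ->
  exists s : 'S_k, {homo f \o s : i j / (i < j)%N}.
Proof.
move=> fI; pose below i := [set j | f j < f i]%N.
have rk i : (#|below i| < k)%N.
  rewrite -[k in (_ < k)%N]card_ord -cardsT; apply: proper_card.
  apply/properP; split; first exact: subsetT.
  by exists i; rewrite ?inE ?ltnn.
have mono i j : (f i < f j)%N -> (#|below i| < #|below j|)%N.
  move=> ij; apply: proper_card; apply/properP; split.
    by apply/fintype.subsetP => x; rewrite !inE => /ltn_trans; apply.
  by exists i; rewrite !inE ?ltnn.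
have rI : injective (fun i => Ordinal (rk i)).
  move=> i j [e]; apply/fI/val_inj/eqP.
  by case: ltngtP => // /mono; rewrite e ltnn.
exists (perm rI)^-1%g => a b ab /=.
rewrite -(permKV (perm rI) a) -(permKV (perm rI) b) in ab.
move: ab; rewrite !permE /= => ab.
rewrite ltnNge leq_eqVlt; apply/negP => /orP[/eqP/val_inj/fI e|/mono].
  by rewrite e ltnn in ab.
by rewrite ltnNge ltnW.
Qed.

Lemma norm_det_mxsub_perm m n k (M : 'M[R]_(m, n)) (p : 'I_k -> 'I_m)
    (f : 'I_k -> 'I_n) (s t : 'S_k) :
  `|\det (mxsub (p \o s) (f \o t) M)| = `|\det (mxsub p f M)|.
Proof.
have -> : mxsub (p \o s) (f \o t) M = row_perm s (col_perm t (mxsub p f M)).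
  by apply/matrixP => i j; rewrite !mxE.
by rewrite row_permE col_permE !det_mulmx !det_perm !normrM !normr_sign mul1r mulr1.
Qed.

Lemma det_mxsub_inj m n k (M : 'M[R]_(m, n)) (p : 'I_k -> 'I_m)
    (f : 'I_k -> 'I_n) : \det (mxsub p f M) != 0 -> injective p /\ injective f.
Proof.
move=> d0; split=> i j e; apply/eqP/negPn/negP => ij; move/eqP: d0; apply.
  by apply: (determinant_alternate ij) => x; rewrite !mxE e.
by rewrite -det_tr; apply: (determinant_alternate ij) => x; rewrite !mxE e.
Qed.

Lemma row_free_det k n (M : 'M[R]_(k, n)) f : \det (colsub f M) != 0 -> row_free M.
Proof.
move=> d0; have u : colsub f M \in unitmx by rewrite unitmxE unitfE.
apply: inj_row_free => v e; apply: (can_inj (mulmxK u)).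
by rewrite mul0mx mulmx_colsub e; apply/matrixP => i j; rewrite !mxE.
Qed.

Lemma equimodular_minor l n (M : 'M[R]_(l, n)) k (u : 'I_k -> 'I_l) f g : k = l ->
  (row_free M -> equimodular M) ->
  \det (mxsub u f M) != 0 -> \det (mxsub u g M) != 0 ->
  `|\det (mxsub u f M)| = `|\det (mxsub u g M)|.
Proof.
move=> kl; subst l => eqM df dg.
have [uI fI] := det_mxsub_inj df; have [_ gI] := det_mxsub_inj dg.
have [s hs] := sorting_perm fI; have [t ht] := sorting_perm gI.
have key h (w : 'S_k) : `|\det (mxsub u h M)| = `|\det (colsub (h \o w) M)|.
  have -> : mxsub u h M = mxsub (id \o perm uI) (h \o (1%g : 'S_k)) M.
    by apply/matrixP => i j; rewrite !mxE /= permE perm1.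
  have -> : colsub (h \o w) M = mxsub (id \o (1%g : 'S_k)) (h \o w) M.
    by apply/matrixP => i j; rewrite !mxE /= perm1.
  by rewrite (norm_det_mxsub_perm M id h (perm uI) 1%g) (norm_det_mxsub_perm M id h 1%g w).
have nz h (w : 'S_k) : \det (mxsub u h M) != 0 -> \det (colsub (h \o w) M) != 0.
  by rewrite -normr_eq0 (key h w) normr_eq0.
have df' := nz f s df; have dg' := nz g t dg.
have [_ eq] := eqM (row_free_det df').
by rewrite (key f s) (key g t); apply: eq.
Qed.

Lemma totally_equimodular_tee m n (A : 'M[R]_(m, n)) : totally_equimodular A -> tee A.
Proof.
move=> teA k p f g df dg; have [pI _] := det_mxsub_inj df.
pose S := [set p i | i : 'I_k].
have pS i : p i \in S by exact: imset_f.
have kS : k = #|S| by rewrite card_imset// card_ord.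
pose u i := enum_rank_in (pS i) (p i).
have e h : mxsub p h A = mxsub u h (row_submx A S).
  by apply/matrixP => i j; rewrite !mxE enum_rankK_in.
by rewrite !e in df dg *; apply: equimodular_minor => //; exact: teA.
Qed.

End Equimodular.

Section Generators.
Variables (R : realType) (n : nat).

Lemma simplicial_generators m k (A : 'M[R]_(m, n)) (B : 'M[R]_(k, n)) :
  row_free B -> row_cone B = row_cone A ->
  exists (l : 'I_k -> 'I_m) (a : 'I_k -> R),
    forall i, 0 < a i /\ row (l i) A = a i *: row i B.
Proof.
move=> fB e.
have [N hN] : exists N : 'M[R]_(k, m), (forall i j, 0 <= N i j) /\ B = N *m A.
  have /choice[N hN] : forall i, exists c : 'rV[R]_m,
      (forall j, 0 <= c 0 j) /\ row i B = c *m A.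
    by move=> i; have := row_cone_row B i; rewrite e => -[c c0 ec]; exists c.
  exists (\matrix_i N i); split=> [i j|]; first by rewrite mxE; case: (hN i).
  by apply/row_matrixP => i; rewrite row_mul rowK; case: (hN i).
have [M hM] : exists M : 'M[R]_(m, k), (forall i j, 0 <= M i j) /\ A = M *m B.
  have /choice[M hM] : forall i, exists c : 'rV[R]_k,
      (forall j, 0 <= c 0 j) /\ row i A = c *m B.
    by move=> i; have := row_cone_row A i; rewrite -e => -[c c0 ec]; exists c.
  exists (\matrix_i M i); split=> [i j|]; first by rewrite mxE; case: (hM i).
  by apply/row_matrixP => i; rewrite row_mul rowK; case: (hM i).
case: hN => N0 eB; case: hM => M0 eA.
have NM : N *m M = 1%:M.
  by apply: (row_free_inj fB); rewrite -mulmxA -eA -eB mul1mx.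
have NMij i j : \sum_t N i t * M t j = (i == j)%:R.
  by have := congr1 (fun X : 'M[R]_k => X i j) NM; rewrite !mxE.
have /choice[l hl] : forall i, exists t, N i t * M t i != 0.
  move=> i; apply: contrapT => h; have := NMij i i; rewrite eqxx big1.
    by move/eqP; rewrite eq_sym oner_eq0.
  by move=> t _; apply/eqP/negPn/negP => ht; apply: h; exists t.
exists l, (fun i => M (l i) i) => i; have := hl i; rewrite mulf_eq0 negb_or => /andP[n0 m0].
split; first by rewrite lt_neqAle eq_sym m0 M0.
rewrite {1}eA row_mul mulmx_sum_row (bigD1 i)//= big1 ?addr0 ?mxE// => j ji.
have := NMij i j; rewrite eq_sym (negbTE ji) => /eqP.
rewrite psumr_eq0 => [/allP/(_ (l i))|t _]; last by rewrite mulr_ge0.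
rewrite mem_index_enum => /(_ isT); rewrite mulf_eq0 (negbTE n0) /= => /eqP h.
by rewrite !mxE h scale0r.
Qed.

Lemma row_cone_scale k (B D : 'M[R]_(k, n)) (a : 'I_k -> R) :
  (forall i, 0 < a i /\ row i D = a i *: row i B) -> row_cone D = row_cone B.
Proof.
move=> h; apply/seteqP; split; apply: row_cone_comb => i; have [a0 e] := h i.
  by rewrite e; apply: row_coneZ; [exact: ltW|exact: row_cone_row].
have -> : row i B = (a i)^-1 *: row i D.
  by rewrite e scalerA mulVf ?scale1r// gt_eqF.
by apply: row_coneZ; rewrite ?invr_ge0 ?ltW//; exact: row_cone_row.
Qed.

Lemma row_free_scale k (B D : 'M[R]_(k, n)) (a : 'I_k -> R) :
  row_free B -> (forall i, 0 < a i /\ row i D = a i *: row i B) -> row_free D.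
Proof.
move=> fB h; have -> : D = diag_mx (\row_i a i) *m B.
  apply/row_matrixP => i; case: (h i) => _ ->; apply/rowP => j.
  by rewrite mul_diag_mx !mxE.
rewrite /row_free mxrankMfree//; apply/eqP/mxrank_unit.
rewrite unitmxE unitfE det_diag; apply/prodf_neq0 => i _.
by rewrite mxE; case: (h i) => a0 _; rewrite gt_eqF.
Qed.

Lemma te_cone_tern (C : set 'rV[R]_n) : te_cone C ->
  exists r (A : 'M[R]_(r, n)), [/\ tee A, tern_mx A, row_free A & C = row_cone A].
Proof.
move=> [[r [B [fB eB]]] [m [A0 [/totally_equimodular_tee teA eA]]]].
have [l [a ha]] := simplicial_generators fB (etrans (esym eB) eA).
have /choice[q hq] := fun i => row_neq0 i fB.
pose b i := `|A0 (l i) (q i)|.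
have Aq i : A0 (l i) (q i) != 0.
  have [a0 /rowP/(_ (q i))] := ha i; rewrite !mxE => ->.
  by rewrite mulf_neq0// gt_eqF.
have b0 i : 0 < b i by rewrite normr_gt0.
pose A : 'M[R]_(r, n) := \matrix_(i, j) ((b i)^-1 * (rowsub l A0) i j).
have hA i : 0 < a i / b i /\ row i A = (a i / b i) *: row i B.
  have [a0 e] := ha i; split; first exact: divr_gt0.
  apply/rowP => j; have /rowP/(_ j) := e; rewrite !mxE => ->.
  by rewrite mulrA (mulrC (b i)^-1).
exists r, A; split.
- by apply: tee_scale; exact: tee_rowsub.
- move=> i j; rewrite tern_norm; rewrite !mxE normrM normfV (gtr0_norm (b0 i)).
  have [->|Aj] := eqVneq (A0 (l i) j) 0; first by rewrite normr0 mulr0 eqxx.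
  have e j' : \det (mxsub (fun _ : 'I_1 => l i) (fun=> j') A0) = A0 (l i) j'.
    by rewrite det_mx11 mxE.
  have := teA 1 (fun=> l i) (fun=> j) (fun=> q i); rewrite !e => /(_ Aj (Aq i)) ->.
  by rewrite -/(b i) mulVf ?eqxx ?orbT// gt_eqF.
- exact: row_free_scale hA.
- by rewrite (row_cone_scale hA).
Qed.

End Generators.

Local Open Scope classical_set_scope.
Local Open Scope ring_scope.

(** * Faces of the subdivision *)

Section Subcones.
Variables (R : realType) (r n : nat).
Implicit Types (B : 'M[R]_(r, n)) (x : 'rV[R]_n) (J : {set 'I_r}).

Definition subcone B J := row_cone (row_submx B J).

Lemma subconeP B J x : row_free B ->
  subcone B J x <-> row_cone B x /\ forall i, i \notin J -> coord B x 0 i = 0.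
Proof.
move=> fB; split=> [[c c0 ->]|[xB x0]].
  rewrite /row_submx rowsubE mulmxA; split.
    eexists; last by [].
    move=> i; rewrite mxE; apply: sumr_ge0 => j _; rewrite !mxE.
    by rewrite mulr_ge0.
  move=> i iJ; rewrite mul_coord// mxE big1// => j _; rewrite !mxE.
  by case: eqP => [e|_]; rewrite ?mulr0//; rewrite -e enum_valP in iJ.
have [xs c0] := (row_coneP x fB).1 xB.
exists (\row_a coord B x 0 (enum_val a)) => [i|]; first by rewrite mxE.
rewrite -{1}(coordK xs) !mulmx_sum_row (bigID (fun i => i \in J))/=.
rewrite [X in _ + X]big1 ?addr0 => [|i iJ]; last by rewrite x0 ?scale0r.
rewrite big_enum_val; apply: eq_bigr => a _; rewrite mxE; congr (_ *: _).
by apply/rowP => j; rewrite !mxE.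
Qed.

Lemma subcone_setT B : row_free B -> subcone B [set: 'I_r]%SET = row_cone B.
Proof.
move=> fB; apply/seteqP; split=> x; first by move/(subconeP _ _ fB) => [].
by move=> xB; apply/(subconeP _ _ fB); split=> // i; rewrite finset.in_setT.
Qed.

Lemma subcone_row B J i : i \in J -> subcone B J (row i B).
Proof.
move=> iJ; have -> : row i B = row (enum_rank_in iJ i) (row_submx B J).
  by apply/rowP => j; rewrite !mxE enum_rankK_in.
exact: row_cone_row.
Qed.

Lemma scalar_coord B (l : {scalar 'rV[R]_n}) x : (x <= B)%MS ->
  l x = \sum_i coord B x 0 i * l (row i B).
Proof.
move=> xB; rewrite -{1}(coordK xB) mulmx_sum_row linear_sum.
by apply: eq_bigr => i _; rewrite linearZ.
Qed.

Lemma face_subcone B J F : row_free B -> face_of F (subcone B J) ->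
  exists2 J' : {set 'I_r}, J' \subset J & F = subcone B J'.
Proof.
move=> fB [l [l0 ->]].
pose J' := finset (fun i => (i \in J) && (l (row i B) == 0)).
have sub : J' \subset J by apply/fintype.subsetP => i; rewrite inE => /andP[].
exists J' => //; apply/seteqP; split=> x.
  move=> [/(subconeP _ _ fB)[xB x0] lx]; apply/(subconeP _ _ fB); split=> // i.
  rewrite inE negb_and; have [iJ /= li|/x0//] := boolP (i \in J).
  have [xs c0] := (row_coneP x fB).1 xB.
  move/eqP: lx; rewrite (scalar_coord _ xs) psumr_eq0 => [/allP/(_ i)|k _].
    by rewrite mem_index_enum mulf_eq0 (negbTE li) orbF => /(_ isT)/eqP.
  have [kJ|/x0->] := boolP (k \in J); last by rewrite mul0r.
  by rewrite mulr_ge0// l0//; exact: subcone_row.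
move=> /(subconeP _ _ fB)[xB x0]; have [xs c0] := (row_coneP x fB).1 xB.
split.
  apply/(subconeP _ _ fB); split=> // i iJ; apply: x0.
  by apply: contra iJ => /(fintype.subsetP sub).
rewrite (scalar_coord _ xs) big1// => i _.
have [|/x0->] := boolP (i \in J'); last by rewrite mul0r.
by rewrite inE => /andP[_ /eqP->]; rewrite mulr0.
Qed.

Lemma lin_is_linear (l : 'cV[R]_n) : linear_for *%R (lin l).
Proof. by move=> a x y; rewrite linD linZ. Qed.
HB.instance Definition _ l :=
  GRing.isLinear.Build R 'rV[R]_n R *%R (lin l) (lin_is_linear l).

Definition off_face B J : 'cV[R]_n := \sum_(i | i \notin J) col i (pinvmx B).

Lemma lin_off_face B J x : lin (off_face B J) x = \sum_(i | i \notin J) coord B x 0 i.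
Proof.
rewrite /lin mulmx_sumr summxE; apply: eq_bigr => i _.
by rewrite /coord -lock colE mulmxA -colE mxE.
Qed.

Lemma off_face_ge0 B J x : row_free B -> row_cone B x -> 0 <= lin (off_face B J) x.
Proof.
move=> fB /(row_coneP _ fB)[_ c0]; rewrite lin_off_face.
by apply: sumr_ge0 => i _.
Qed.

Lemma off_face_eq0 B J x : row_free B -> row_cone B x ->
  subcone B J x <-> lin (off_face B J) x = 0.
Proof.
move=> fB xB; have [_ c0] := (row_coneP _ fB).1 xB; rewrite lin_off_face; split.
  by move=> /(subconeP _ _ fB)[_ x0]; rewrite big1.
move/eqP; rewrite psumr_eq0// => /allP h; apply/(subconeP _ _ fB); split=> // i iJ.
by have := h i; rewrite mem_index_enum iJ => /(_ isT)/eqP.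
Qed.

Lemma subcone_face B J J' : row_free B -> J' \subset J ->
  face_of (subcone B J') (subcone B J).
Proof.
move=> fB sub; exists (lin (off_face B J')); split=> [x|].
  by move=> /(subconeP _ _ fB)[xB _]; exact: off_face_ge0.
apply/seteqP; split=> x; last first.
  by move=> [/(subconeP _ _ fB)[xB _]]; move/(off_face_eq0 _ fB xB).
move=> h; have [xB x0] := (subconeP _ _ fB).1 h; split.
  apply/(subconeP _ _ fB); split=> // i iJ; apply: x0.
  by apply: contra iJ => /(fintype.subsetP sub).
exact/(off_face_eq0 _ fB xB).
Qed.

End Subcones.

Section Faces.
Variables (R : realType) (r n : nat) (A : 'M[R]_(r, n)).
Variable K : seq ('M[R]_(r, n) * 'cV[R]_n).
Hypothesis rK : regular_complex A K.

Definition faces : set (set 'rV[R]_n) :=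
  [set D | exists2 P, P \in K & exists J, D = subcone P.1 J].

Let Kfree P : P \in K -> row_free P.1.
Proof. by case: rK => h _ _ /h[]. Qed.

Lemma subconeI P P' (J J' : {set 'I_r}) : P \in K -> P' \in K ->
  exists2 J2 : {set 'I_r}, J2 \subset J & subcone P.1 J `&` subcone P'.1 J' = subcone P.1 J2.
Proof.
move=> PK PK'; have fP := Kfree PK; have fP' := Kfree PK'.
pose F := subcone P.1 J `&` row_cone P'.1.
have [J1 J1J eF] : exists2 J1 : {set 'I_r}, J1 \subset J & F = subcone P.1 J1.
  apply: face_subcone => //; exists (lin (P.2 - P'.2)).
  have e x : lin (P.2 - P'.2) x = lin P.2 x - lin P'.2 x.
    by rewrite /lin mulmxBr !mxE.
  split=> [x /(subconeP _ _ fP)[xP _]|].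
    by rewrite /= e subr_ge0; case: (complex_le rK PK' PK xP).
  apply/seteqP; split=> x [xJ].
    have [xP _] := (subconeP _ _ fP).1 xJ; have [_ h] := complex_le rK PK' PK xP.
    by move=> /h e'; split=> //; rewrite /= e e' subrr.
  have [xP _] := (subconeP _ _ fP).1 xJ; have [_ h] := complex_le rK PK' PK xP.
  by rewrite /= e => /eqP; rewrite subr_eq0 => /eqP/esym/h.
have [J2 J2J e2] : exists2 J2 : {set 'I_r}, J2 \subset J1 &
    subcone P.1 J `&` subcone P'.1 J' = subcone P.1 J2.
  apply: face_subcone => //; exists (lin (off_face P'.1 J')); rewrite -eF.
  split=> [x [_ xP']|]; first exact: off_face_ge0.
  apply/seteqP; split=> x.
    move=> [xJ xJ']; have [xP' _] := (subconeP _ _ fP').1 xJ'.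
    by split=> //; exact/(off_face_eq0 _ fP' xP').
  by move=> [[xJ xP']] /(off_face_eq0 _ fP' xP').
by exists J2 => //; exact: fintype.subset_trans J1J.
Qed.

Lemma faces_triangulation : triangulation (row_cone A) faces.
Proof.
have [K1 K2 _] := rK; split.
- apply: (@sub_finite_set _ _ [set subcone Q.1.1 Q.2 | Q in
    [set` [seq (P, J) | P <- K, J <- enum {: {set 'I_r}}]]]).
    move=> D [P PK [J ->]]; exists (P, J) => //=.
    by apply: allpairs_f; rewrite ?mem_enum.
  by apply: finite_image; exact: finite_seq.
- move=> D [P PK [J ->]]; exists #|J|, (row_submx P.1 J); split=> //.
  by apply: rowsub_free; [exact: enum_val_inj|exact: Kfree].
- apply/seteqP; split=> x.
    move=> [D [P PK [J ->]]] /(subconeP _ _ (Kfree PK))[xP _].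
    by have [_ _ sub] := K1 P PK; exact: sub.
  move=> /K2[P PK xP]; exists (row_cone P.1) => //; exists P => //.
  by exists [set: 'I_r]%SET; rewrite subcone_setT// Kfree.
- move=> D F [P PK [J ->]] /(face_subcone (Kfree PK))[J' _ ->].
  by exists P => //; exists J'.
- move=> D E [P PK [J ->]] [P' PK' [J' ->]]; split.
    have [J2 J2J ->] := subconeI J J' PK PK'.
    by apply: subcone_face => //; exact: Kfree.
  have [J2 J2J] := subconeI J' J PK' PK; rewrite classical_sets.setIC => ->.
  by apply: subcone_face => //; exact: Kfree.
Qed.

End Faces.

(** * Hilbert basis and lattice bases *)

Section HilbertBasis.
Variables (R : realType) (r n : nat) (A : 'M[R]_(r, n)).
Hypothesis fA : row_free A.
Variable K : seq ('M[R]_(r, n) * 'cV[R]_n).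
Hypothesis rK : regular_complex A K.
Hypothesis irrK : forall P k, P \in K -> irreducible A (row k P.1).
Hypothesis intK : forall P x i, P \in K -> lattice A x ->
  coord P.1 x 0 i \is a Num.int.

Let Kfree P : P \in K -> row_free P.1.
Proof. by case: rK => h _ _ /h[]. Qed.

Lemma irreducible_sum h k (g : 'I_k -> 'rV[R]_n) (c : 'I_k -> nat) :
  irreducible A h -> (forall i, lattice_cone A (g i)) ->
  h = \sum_(i < k) g i *+ c i -> exists i, h = g i.
Proof.
move=> [lh hn irr].
have lc0 : lattice_cone A 0.
  by split=> [|j]; [exact: row_cone0|rewrite mxE rpred0].
have lcM v m : lattice_cone A v -> lattice_cone A (v *+ m).
  by move=> lv; elim: m => // m IH; rewrite mulrS; exact: lattice_coneD.
have one v m : lattice_cone A v -> h = v *+ m -> h = v.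
  move=> lv; elim: m => [e|m IH]; first by rewrite e mulr0n eqxx in hn.
  rewrite mulrS => e; case: (irr v (v *+ m) lv (lcM v m lv) e) => e0.
    by move: hn; rewrite e e0 mul0rn addr0 eqxx.
  by rewrite e e0 addr0.
elim: k g c => [|k IH] g c lg; first by rewrite big_ord0 => e; rewrite e eqxx in hn.
rewrite big_ord_recr /= => e.
have ls : lattice_cone A (\sum_(i < k) g (widen_ord (leqnSn k) i) *+ c (widen_ord (leqnSn k) i)).
  elim/big_ind: _ => // [x y|i _]; [exact: lattice_coneD|exact: lcM].
case: (irr _ _ ls (lcM _ _ (lg ord_max)) e) => e0; rewrite e0 ?add0r ?addr0 in e.
  by exists ord_max; exact: one e.
by have [|i] := IH _ _ _ e; [move=> i; exact: lg|exists (widen_ord (leqnSn k) i)].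
Qed.

Lemma irreducible_generates :
  integrally_generates (row_cone A) (irreducible A : set 'rV[R]_n).
Proof.
split=> [h [[hA ih] _ _]//|x [xA ix]]; have [K1 K2 _] := rK.
have [P PK xP] := K2 x xA; have [xs c0] := (row_coneP _ (Kfree PK)).1 xP.
have lx : lattice A x by exact: lattice_coneW.
have /choice[c hc] : forall i, exists m, coord P.1 x 0 i = m%:R.
  by move=> i; apply/natrP; rewrite natrEint intK//= c0.
exists r, (fun i => row i P.1), c; split=> [i|]; first exact: irrK.
rewrite -[LHS](coordK xs) mulmx_sum_row; apply: eq_bigr => i _.
by rewrite hc scaler_nat.
Qed.

Lemma irreducible_hilbert_basis :
  hilbert_basis (row_cone A) (irreducible A : set 'rV[R]_n).
Proof.
have least D : integrally_generates (row_cone A) D -> irreducible A `<=` D.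
  move=> [DC gen] h ih; have [lh _ _] := ih.
  have [k [g [c [gD e]]]] := gen h lh.
  by have [i ->] := irreducible_sum ih (fun i => DC _ (gD i)) e.
apply/seteqP; split=> D.
  move=> [gD minD] /=; symmetry; apply: minD; first exact: irreducible_generates.
  exact: least.
move=> ->; split; first exact: irreducible_generates.
by move=> D' gD' sub; apply/seteqP; split=> //; exact: least.
Qed.

Lemma faces_hilbert : hilbert_triangulation (row_cone A) (faces K).
Proof.
split; first exact: faces_triangulation.
exists (irreducible A : set 'rV[R]_n); first exact: irreducible_hilbert_basis.
move=> D [P PK [J ->]]; exists #|J|, (row_submx P.1 J); split=> // i.
have -> : row i (row_submx P.1 J) = row (enum_val i) P.1.
  by apply/rowP => j; rewrite !mxE.
exact: irrK.
Qed.

Lemma faces_unimodular : unimodular_triangulation (row_cone A) (faces K).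
Proof.
split; first exact: faces_triangulation.
move=> D [P PK [J ->]]; have fP := Kfree PK; set B := row_submx P.1 J.
have fB : row_free B by apply: rowsub_free => //; exact: enum_val_inj.
have rowB i : row i B = row (enum_val i) P.1 by apply/rowP => j; rewrite !mxE.
exists #|J|, B; split=> //; split=> [i|x [[k [M [MD xM]]] ix]].
  split; last by rewrite rowB; case: (irrK (enum_val i) PK) => -[].
  by exists #|J|, B; split=> [j|]; [exact: row_cone_row|exact: row_sub].
have xB : (x <= B)%MS.
  apply: submx_trans xM _; apply/row_subP => i.
  by have [c _ ->] := MD i; exact: submxMl.
have [K1 _ _] := rK; have [_ /andP[PA _] _] := K1 P PK.
have lx : lattice A x.
  split=> //; apply: submx_trans xB (submx_trans _ PA); apply/row_subP => i.
  by rewrite rowB row_sub.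
have /choice[z hz] : forall a, exists m : int, coord B x 0 a = m%:~R.
  move=> a; apply/intrP.
  have -> : coord B x 0 a = coord P.1 x 0 (enum_val a); last exact: intK.
  have e : x = coord B x *m rowsub enum_val 1%:M *m P.1.
    by rewrite -mulmxA -rowsubE coordK.
  rewrite {2}e mul_coord// mxE (bigD1 a)//= big1 ?addr0 => [|b ba].
    by rewrite !mxE eqxx mulr1.
  by rewrite !mxE (inj_eq enum_val_inj) (negbTE ba) mulr0.
have ez : x = map_mx intr (\row_a z a) *m B.
  by rewrite -{1}(coordK xB); congr (_ *m _); apply/rowP => a; rewrite !mxE hz.
exists (\row_a z a); split=> // z' e'.
apply/rowP => a; have /rowP/(_ a) := row_free_inj fB (etrans (esym ez) e').
by rewrite !mxE => /intr_inj.
Qed.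

End HilbertBasis.

(** * Regularity *)

Section Regularity.
Variables (R : realType) (r n : nat) (A : 'M[R]_(r, n)).
Variable K : seq ('M[R]_(r, n) * 'cV[R]_n).
Hypothesis rK : regular_complex A K.
Variable P0 : 'M[R]_(r, n) * 'cV[R]_n.
Hypothesis P0K : P0 \in K.
Implicit Type P : ('M[R]_(r, n) * 'cV[R]_n)%type.

Let C := row_cone A.

Definition max_lin (L : seq ('M[R]_(r, n) * 'cV[R]_n)) (x : 'rV[R]_n) : R :=
  foldr (fun P m => Num.max (lin P.2 x) m) (lin P0.2 x) L.

Lemma max_lin_ge L P x : P \in L -> lin P.2 x <= max_lin L x.
Proof.
elim: L => //= Q L IH; rewrite inE le_max => /orP[/eqP->|/IH->].
  by rewrite lexx.
by rewrite orbT.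
Qed.

Lemma max_lin_eq P x : P \in K -> row_cone P.1 x -> max_lin K x = lin P.2 x.
Proof.
move=> PK xP; apply/eqP; rewrite eq_le max_lin_ge// andbT.
have : {subset K <= K} by [].
elim: {-2}K => [|Q L IH] sub /=.
  by case: (complex_le rK P0K PK xP).
rewrite ge_max; apply/andP; split.
  by case: (complex_le rK (sub Q (mem_head _ _)) PK xP).
by apply: IH => S SL; apply: sub; rewrite inE SL orbT.
Qed.

Lemma max_lin_cone P x : P \in K -> C x -> max_lin K x = lin P.2 x -> row_cone P.1 x.
Proof.
move=> PK xC e; have [_ cov _] := rK; have [Q QK xQ] := cov x xC.
have [_ h] := complex_le rK PK QK xQ; apply/h.
by rewrite -e (max_lin_eq QK xQ).
Qed.

Lemma lin_continuous (l : 'cV[R]_n) : continuous (lin l : 'rV[R]_n -> R).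
Proof.
have -> : lin l = fun x : 'rV[R]_n => \sum_j x 0 j * l j 0.
  by apply/funext => x; rewrite /lin mxE.
apply: continuous_big => [|j _]; first exact: (@add_continuous R).
move=> x; apply: (@continuousM R _ (fun y : 'rV[R]_n => y 0 j) (fun=> l j 0));
  last exact: cst_continuous.
exact: coord_continuous.
Qed.

Lemma max_lin_continuous L : continuous (max_lin L).
Proof.
elim: L => [|P L IH]; first exact: lin_continuous.
move=> x; apply: (@continuous_max _ _ (lin P.2) (max_lin L)); last exact: IH.
exact: lin_continuous.
Qed.

Lemma row_cone_conv m (B : 'M[R]_(m, n)) x y (t : {i01 R}) :
  row_cone B x -> row_cone B y -> row_cone B (t%:num *: x + (1 - t%:num) *: y).
Proof.
by move=> xB yB; apply: row_coneD; apply: row_coneZ.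
Qed.

Lemma max_lin_convex : @convex_function R 'rV[R]_n C (max_lin K).
Proof.
move=> t x y; rewrite !in_setE => xC yC.
have zC : C (t%:num *: x + (1 - t%:num) *: y) by exact: row_cone_conv.
have [_ cov _] := rK; have [P PK zP] := cov _ zC.
rewrite convRE [leLHS](max_lin_eq PK zP) linD !linZ; apply: lerD.
  by apply: ler_wpM2l => //; exact: max_lin_ge.
by apply: ler_wpM2l; [rewrite subr_ge0|exact: max_lin_ge].
Qed.

Lemma complex_cone_domain P : P \in K ->
  linearity_domain C (max_lin K) (row_cone P.1).
Proof.
move=> PK; have [K1 _ _] := rK; have [_ _ sub] := K1 P PK; split=> //.
  by move=> x y t; rewrite !in_setE => xP yP; exact: row_cone_conv.
by exists (lin P.2) => x; exact: max_lin_eq.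
Qed.

Lemma linearity_domain_sub D : linearity_domain C (max_lin K) D ->
  exists2 P, P \in K & D `<=` row_cone P.1.
Proof.
move=> [DC cD [l hl]]; apply: contrapT => h.
have out P : P \in K -> exists2 x, D x & ~ row_cone P.1 x.
  move=> PK; apply: contrapT => h'; apply: h; exists P => // x Dx.
  by apply: contrapT => nx; apply: h'; exists x.
have [x0 Dx0 _] := out P0 P0K.
have [z Dz nz] : exists2 z, D z & forall P, P \in K -> ~ row_cone P.1 z.
  have : {subset K <= K} by [].
  elim: {-2}K => [|P L IH] sub; first by exists x0.
  have [z Dz nz] : exists2 z, D z & forall P, P \in L -> ~ row_cone P.1 z.
    by apply: IH => S SL; apply: sub; rewrite inE SL orbT.
  have [x Dx nx] := out P (sub P (mem_head _ _)).
  have [w [ew Dw]] : exists w, w = 2^-1 *: (x + z) /\ D w.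
    have h0 : 0 <= (2^-1 : R) by lra.
    have h1 : (2^-1 : R) <= 1 by lra.
    have e : (2^-1 : R) = 1 - 2^-1 by lra.
    exists (2^-1 *: (x + z)); split=> //; rewrite scalerDr {2}e.
    by have := cD x z (Itv01 h0 h1); rewrite !in_setE; apply.
  exists w => // Q QL wQ; have QK := sub Q QL.
  have fw : max_lin K w = 2^-1 * (max_lin K x + max_lin K z).
    by rewrite !hl// ew linearZ /= linearD.
  have := fw; rewrite (max_lin_eq QK wQ) {1}ew linZ linD.
  have gx := max_lin_ge x QK; have gz := max_lin_ge z QK => e.
  move: QL; rewrite inE => /orP[/eqP eQ|QL].
    by apply: nx; rewrite -eQ; apply: max_lin_cone (DC _ Dx) _ => //; lra.
  by apply: (nz Q QL); apply: max_lin_cone (DC _ Dz) _ => //; lra.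
have [_ cov _] := rK; have [P PK zP] := cov z (DC z Dz).
exact: nz P PK zP.
Qed.

Lemma complex_cone_sub P Q : P \in K -> Q \in K ->
  row_cone P.1 `<=` row_cone Q.1 -> row_cone Q.1 = row_cone P.1.
Proof.
move=> PK QK sub; apply/seteqP; split=> // x xQ.
have [_ h] := complex_le rK PK QK xQ; apply/h.
have [K1 _ _] := rK; have [_ /andP[_ AP] _] := K1 P PK; have [_ /andP[QA _] _] := K1 Q QK.
have xP : (x <= P.1)%MS.
  by have [c _ ->] := xQ; exact: submx_trans (submxMl _ _) (submx_trans QA AP).
rewrite -(coordK xP) !lin_sum; apply: eq_bigr => i _; congr (_ * _).
have xi := row_cone_row P.1 i.
by rewrite -!(max_lin_eq _ (sub _ xi))// (max_lin_eq PK xi).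
Qed.

Lemma maximal_complex_cones (Q : set (set 'rV[R]_n)) :
  (forall P, P \in K -> Q (row_cone P.1)) ->
  (forall D, Q D -> exists2 P, P \in K & D `<=` row_cone P.1) ->
  maximal_sets Q = [set D | exists2 P, P \in K & D = row_cone P.1].
Proof.
move=> QK QD; apply/seteqP; split=> D.
  move=> [/QD[P PK sub] maxD]; exists P => //.
  by rewrite (maxD _ (QK P PK) sub).
move=> [P PK ->]; split; first exact: QK.
move=> D' /QD[P' PK' sub'] sub; apply/seteqP; split=> //.
by rewrite -(complex_cone_sub PK PK')// => x /sub/sub'.
Qed.

Lemma faces_regular : regular_triangulation C (faces K).
Proof.
have Kfree P : P \in K -> row_free P.1 by case: rK => h _ _ /h[].
have subP P (J : {set 'I_r}) : P \in K -> subcone P.1 J `<=` row_cone P.1.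
  by move=> PK x /(subconeP _ _ (Kfree P PK))[].
split; first exact: faces_triangulation.
exists (max_lin K); split.
- by apply: continuous_subspaceT; exact: max_lin_continuous.
- exact: max_lin_convex.
- move=> D [P PK [J ->]]; exists (lin P.2) => x /(subP _ _ PK).
  exact: max_lin_eq.
rewrite (maximal_complex_cones complex_cone_domain linearity_domain_sub).
rewrite maximal_complex_cones// => [P PK|D [P PK [J ->]]].
  by exists P => //; exists [set: 'I_r]%SET; rewrite subcone_setT// Kfree.
by exists P => //; exact: subP.
Qed.

End Regularity.

Theorem corollary1p3 (R : realType) (n : nat) (C : set 'rV[R]_n)
    (hC : te_cone C) :
  exists T : set (set 'rV[R]_n),
    [/\ regular_triangulation C T,
        unimodular_triangulation C T &
        hilbert_triangulation C T].
Proof.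
have [r [A [teA trA fA ->]]] := te_cone_tern hC.
have [hs [irr_hs unim]] := unimodular_chain teA trA fA.
have [|K rK chK] := stellar_chain_complex fA (hs := hs).
  by move=> h /irr_hs[[hA _] hn _].
have irrK P k : P \in K -> irreducible A (row k P.1).
  by move=> /chK/unim[[_ _ iP] _].
have intK P x i : P \in K -> lattice A x -> coord P.1 x 0 i \is a Num.int.
  by move=> /chK/unim[_ h] lx; exact: h.
have [P0 P0K _] : exists2 P, P \in K & row_cone P.1 0.
  by case: rK => _ cov _; apply: cov; exact: row_cone0.
exists (faces K); split.
- exact: faces_regular P0K.
- exact: faces_unimodular.
- exact: faces_hilbert.
Qed.
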